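(* Let $B$ be an integral square matrix whose minimal polynomial over $\mathbb{Q}$ is $m_B(x)=x(x-\alpha)(x-\beta)$, where $0,\alpha,\beta$ are distinct integers. Then for each prime divisor $p$ of $\alpha\beta(\beta-\alpha)$ there is a polynomial $\delta_p(x)\in\mathbb{Z}[x]$ such that, as formal Dirichlet series, $$\zeta_{\langle B\rangle}(s)=\prod_{p\mid \alpha\beta(\beta-\alpha)}\delta_p(p^{-s})\cdot \zeta(s)^3,$$ where $p$ runs through the prime divisors of $\alpha\beta(\beta-\alpha)$ and $\zeta(s)$ is the Riemann zeta function.
   Context: For an integral square matrix $B\in M_v(\mathbb{Z})$, $\langle B\rangle=\{f(B)\mid f(x)\in\mathbb{Z}[x]\}$ is the subring of $M_v(\mathbb{Z})$ generated by $B$. It is a free $\mathbb{Z}$-module of finite rank, so for each $n\ge 1$ the number $a_n$ of ideals of $\langle B\rangle$ of index $n$ is finite, and $\zeta_{\langle B\rangle}(s)=\sum_{n\ge1}a_n n^{-s}$ as a formal Dirichlet series. The series $\zeta(s)=\sum_{n\ge 1}n^{-s}$ is viewed as a formal Dirichlet series as well. *)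

(* Defs.v *)
From mathcomp Require Import all_boot all_order all_algebra finmap.
From mathcomp Require Import boolp classical_sets functions cardinality.

Set Implicit Arguments.
Unset Strict Implicit.
Unset Printing Implicit Defensive.

Import Order.TTheory GRing.Theory Num.Theory.
Local Open Scope classical_set_scope.
Local Open Scope ring_scope.

(* Two-sided ideals of a subring S of M. The unit ideal S itself is included,
   unlike in the library's idealr_closed, which requires proper ideals. *)
Definition ideal_of (M : pzRingType) (S I : set M) : Prop :=
  [/\ I `<=` S,
      I 0,
      forall x y, I x -> I y -> I (x - y)
    & forall r x, S r -> I x -> I (r * x) /\ I (x * r)].

Definition cosets (M : pzRingType) (S I : set M) : set (set M) :=
  [set [set x + y | y in I] | x in S].

Definition ideals_of_index (M : pzRingType) (S : set M) (n : nat) :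
    set (set M) :=
  [set I | ideal_of S I /\ (cosets S I #= `I_n)%card].

Definition gen_subring (v : nat) (B : 'M[int]_v.+1) : set 'M[int]_v.+1 :=
  [set horner_mx B f | f in [set: {poly int}]].

(* A formal Dirichlet series sum_(n >= 1) f n * n^-s is given by its
   coefficients; the value f 0 carries no meaning and is ignored. *)
Definition dirichlet := nat -> int.

Definition dirichlet_eq (f g : dirichlet) : Prop :=
  forall n : nat, (0 < n)%N -> f n = g n.

Definition dirichlet_one : dirichlet := fun n => (n == 1%N)%:R.

Definition dirichlet_mul (f g : dirichlet) : dirichlet :=
  fun n => \sum_(d <- divisors n) f d * g (n %/ d)%N.

Definition dirichlet_exp (f : dirichlet) (k : nat) : dirichlet :=
  iter k (dirichlet_mul f) dirichlet_one.

Definition riemann_zeta : dirichlet := fun=> 1.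

(* The Dirichlet series q(p^-s): the coefficient q`_k sits at n = p ^ k. *)
Definition dirichlet_poly (p : nat) (q : {poly int}) : dirichlet :=
  fun n => \sum_(k < size q) q`_k *+ (n == p ^ k)%N.

(* fset_set returns the empty set on an infinite set. This never happens for
   S = gen_subring B and n > 0: S is a finitely generated abelian group, so it
   has finitely many subgroups of each finite index. *)
Definition ideal_zeta (M : pzRingType) (S : set M) : dirichlet :=
  fun n => (#|` fset_set (ideals_of_index S n)|%fset)%:Z.

(* Main.v *)
From HB Require Import structures.
Require Import Defs.
From mathcomp Require Import all_boot all_order all_algebra.
From mathcomp Require Import fingroup cyclic pgroup.
From mathcomp Require Import finmap boolp classical_sets functions cardinality.
From mathcomp Require Import zify ring.

Set Implicit Arguments.
Unset Strict Implicit.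
Unset Printing Implicit Defensive.

Import Order.TTheory GRing.Theory Num.Theory.
Local Open Scope classical_set_scope.
Local Open Scope ring_scope.

(* Evaluation at 0, alpha, beta embeds <B> as a subring S of Z^3 containing
   N Z^3, where N = |alpha beta (beta - alpha)|.  For any subring S of Z^d
   containing N Z^d, the number a(n) of ideals of index n is multiplicative (by
   the Chinese remainder theorem), so only the sequences k |-> a(p^k) matter,
   and the Euler factor at p of zeta_S(s) / zeta(s)^d has as coefficients the
   d-th backward differences of this sequence.  These differences vanish for
   k > 2 d v_p(N): after replacing S by its localisation at p, which contains
   p^e Z^d for e = v_p(N), multiplication of the i-th coordinate by p
   is a bijection from the ideals of index p^k with i-th coordinates divisible
   by p^e to those of index p^(k+1) with i-th coordinates divisible by p^(e+1).
   Hence one difference may be traded for a bound on the content of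
   one coordinate, and the ideals whose contents are all bounded contain
   p^(2 e) Z^d, so that their index is bounded. *)

(** * Indices of subgroups *)

Section Index.

Variable M : zmodType.
Implicit Types (G H K : set M) (x y : M).

Definition subgroup H := H 0 /\ forall x y, H x -> H y -> H (x - y).

Lemma subgroupN H x : subgroup H -> H x -> H (- x).
Proof. by move=> [H0 HB] Hx; rewrite -sub0r; apply: HB. Qed.

Lemma subgroupB H x y : subgroup H -> H x -> H y -> H (x - y).
Proof. by move=> [_ HB]; apply: HB. Qed.

Lemma subgroupD H x y : subgroup H -> H x -> H y -> H (x + y).
Proof.
by move=> sH Hx Hy; rewrite -[y]opprK; apply: subgroupB=> //; apply: subgroupN.
Qed.

Lemma subgroupMn H x n : subgroup H -> H x -> H (x *+ n).
Proof.
move=> sH Hx; elim: n => [|n IHn]; first by rewrite mulr0n; case: sH.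
by rewrite mulrS; apply: subgroupD.
Qed.

Lemma subgroupMz H x (m : int) : subgroup H -> H x -> H (x *~ m).
Proof.
move=> sH Hx; case: m => n; first by rewrite -pmulrn; apply: subgroupMn.
by rewrite NegzE mulrNz -pmulrn; apply: subgroupN => //; apply: subgroupMn.
Qed.

Lemma subgroup_subC H x y : subgroup H -> H (x - y) -> H (y - x).
Proof. by move=> sH; rewrite -[y - x]opprB; apply: subgroupN. Qed.

(** The coefficients in the Bezout identity are chosen before [x], so that one decomposition serves
    all elements. *)
Lemma coprime_decomp m n : coprime m n ->
  exists u v : int, forall x, x = x *+ m *~ u + x *+ n *~ v.
Proof.
rewrite /coprime => /eqP cmn; have [u [v e]] := Bezoutz m n; exists u, v => x.
rewrite !pmulrn -!mulrzA -mulrzDr ![_%:Z * _]mulrC e.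
by rewrite /gcdz /= cmn mulr1z.
Qed.

Lemma subgroup_coprime H x m n : subgroup H -> coprime m n ->
  H (x *+ m) -> H (x *+ n) -> H x.
Proof.
move=> sH /coprime_decomp[u [v e]] Hm Hn; rewrite [x]e.
by apply: subgroupD => //; apply: subgroupMz.
Qed.

(* [f] labels the cosets of [H] in [G] by ['I_n]. *)
Definition has_index G H n := exists f : M -> 'I_n,
  (forall x y, G x -> G y -> f x = f y <-> H (x - y)) /\
  (forall i, exists2 x, G x & f x = i).

Lemma has_index_label G H (T : finType) (f : M -> T) :
  (forall x y, G x -> G y -> f x = f y <-> H (x - y)) ->
  (forall t, exists2 x, G x & f x = t) -> has_index G H #|T|.
Proof.
move=> fH fG; exists (enum_rank \o f); split=> [x y Gx Gy /=|i].
  by rewrite -fH //; split=> [/enum_rank_inj|->].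
have [x Gx fx] := fG (enum_val i).
by exists x; rewrite //= fx enum_valK.
Qed.

(** Surjectivity is forced by shrinking [T] to the labels attained on [G]. The label of [0] is the
    default value for elements outside [G]. *)
Lemma has_index_exists G H (T : finType) (f : M -> T) : G 0 ->
  (forall x y, G x -> G y -> f x = f y <-> H (x - y)) ->
  exists n, has_index G H n.
Proof.
move=> G0 fH; pose S := {t : T | `[< exists2 x, G x & f x = t >]}.
have S0 : `[< exists2 x, G x & f x = f 0 >] by apply/asboolP; exists 0.
pose g x : S := insubd (exist _ (f 0) S0 : S) (f x).
have gE x : G x -> sval (g x) = f x.
  by move=> Gx; rewrite val_insubd; case: ifP => // /asboolP[]; exists x.
exists #|{: S}|; apply: (has_index_label (f := g)) => [x y Gx Gy|].
  rewrite -fH //; split=> [/(congr1 val)|fxy]; first by rewrite /= !gE.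
  by apply: val_inj; rewrite /= !gE.
move=> [t St]; have /asboolP[x Gx fx] := St.
by exists x => //; apply: val_inj; rewrite /= gE.
Qed.

Lemma has_index_gt0 G H n : has_index G H n -> (0 < n)%N.
Proof. by case=> f _; case: n f => // f; case: (f 0). Qed.

(** Representatives of distinct cosets of [H] remain distinct modulo the smaller [K]. *)
Lemma has_index_mono G H K m n : K `<=` H ->
  has_index G H m -> has_index G K n -> (m <= n)%N.
Proof.
move=> KH [f [fH fG]] [g [gK gG]].
have /choice[r rP] i : exists x, G x /\ f x = i.
  by have [x Gx <-] := fG i; exists x.
have : injective (g \o r).
  move=> i j /= gij; rewrite -(rP i).2 -(rP j).2; apply/fH; try exact: (rP _).1.
  by apply: KH; apply/gK => //; exact: (rP _).1.
by move/leq_card; rewrite !card_ord.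
Qed.

Lemma has_index_uniq G H m n : has_index G H m -> has_index G H n -> m = n.
Proof.
by move=> Hm Hn; apply/eqP; rewrite eqn_leq !(@has_index_mono G H H).
Qed.

(** An element of [G] is labelled by its coset modulo [H], together with the coset modulo [K] of its
    difference with the chosen representative. *)
Lemma has_index_tower G H K m n : subgroup G -> subgroup H -> subgroup K ->
  H `<=` G -> K `<=` H ->
  has_index G H m -> has_index H K n -> has_index G K (m * n).
Proof.
move=> sG sH sK HG KH [f [fH fG]] [g [gK gH]].
have /choice[r rP] i : exists x, G x /\ f x = i.
  by have [x Gx <-] := fG i; exists x.
have Hr x : G x -> H (x - r (f x)).
  by move=> Gx; apply/fH => //; rewrite ?(rP _).2 //; exact: (rP _).1.
have -> : (m * n)%N = #|{: 'I_m * 'I_n}| by rewrite card_prod !card_ord.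
pose h x := (f x, g (x - r (f x))).
apply: (has_index_label (f := h)) => [x y Gx Gy|[i j]].
  split=> [[fxy gxy]|Kxy].
    have := (gK _ _ (Hr _ Gx) (Hr _ Gy)).1 gxy.
    by rewrite fxy opprB addrA addrNK.
  have fxy : f x = f y by apply/fH => //; apply: KH.
  congr (_, _) => //; apply/gK; try exact: Hr.
  by rewrite fxy opprB addrA addrNK.
have [y Hy gy] := gH j; exists (r i + y).
  by apply: subgroupD => //; [exact: (rP _).1|exact: HG].
have -> : h (r i + y) = (i, g (r i + y - r i)).
  suff e : f (r i + y) = i by rewrite /h e.
  rewrite -[RHS](rP i).2; apply/fH; last by rewrite addrAC subrr add0r.
    by apply: subgroupD => //; [exact: (rP _).1|exact: HG].
  exact: (rP _).1.
by rewrite addrAC subrr add0r gy.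
Qed.

Lemma has_index_split G H K n : subgroup G -> subgroup H -> subgroup K ->
  H `<=` G -> K `<=` H -> has_index G K n ->
  exists m l, [/\ has_index G H m, has_index H K l & (m * l)%N = n].
Proof.
move=> sG sH sK HG KH Gn; have [f [fK fG]] := Gn.
have [m Gm] : exists m, has_index G H m.
  (* A coset of [H] is encoded by the finite set of labels of the cosets of [K] that it contains. *)
  pose h x := [set t : 'I_n | `[< exists y, [/\ G y, f y = t & H (x - y)] >]]%SET.
  apply: (has_index_exists (f := h)) => [|x y Gx Gy]; first by case: sG.
  split=> [/setP/(_ (f y))|Hxy].
    rewrite !inE; have -> : `[< exists z, [/\ G z, f z = f y & H (y - z)] >].
      by apply/asboolP; exists y; rewrite subrr; split=> //; case: sH.
    move=> /asboolP[z [Gz /fK fzy Hxz]].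
    rewrite -[x](subrK z) -addrA; apply: subgroupD => //.
    by apply: KH; apply: fzy.
  apply/setP=> t; rewrite !inE; apply/asboolP/asboolP => -[z [Gz fz Hz]].
    exists z; split=> //; rewrite -[y](subrK x) -addrA.
    by apply: subgroupD => //; apply: subgroup_subC.
  by exists z; split=> //; rewrite -[x](subrK y) -addrA; apply: subgroupD.
have [l Hl] : exists l, has_index H K l.
  apply: (has_index_exists (f := f)) => [|x y Hx Hy]; first by case: sH.
  by apply: fK; apply: HG.
exists m, l; split=> //.
exact: has_index_uniq (has_index_tower sG sH sK HG KH Gm Hl) Gn.
Qed.

(** The labels receive the group law of [G / H] through representatives. This gives access to
    Lagrange's and Cauchy's theorems for finite groups even when [G] is infinite. *)
Lemma has_index_quotient G H n : subgroup G -> subgroup H -> has_index G H n ->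
  exists (gT : finGroupType) (g : M -> gT),
  [/\ #|[set: gT]%G| = n,
      forall x k, G x -> g (x *+ k) = (g x ^+ k)%g,
      forall x, G x -> g x = 1%g <-> H x
    & forall t, exists2 x, G x & g x = t].
Proof.
move=> sG sH [f [fH fG]].
have /choice[r rP] i : exists x, G x /\ f x = i.
  by have [x Gx <-] := fG i; exists x.
have Gr i : G (r i) := (rP i).1.
have fr i : f (r i) = i := (rP i).2.
have G0 : G 0 by case: sG.
have rf x : G x -> H (r (f x) - x) by move=> Gx; apply/fH.
pose mul i j := f (r i + r j); pose one := f 0; pose inv i := f (- r i).
have fD x y : G x -> G y -> f (x + y) = mul (f x) (f y).
  move=> Gx Gy; apply/fH; try exact: subgroupD.
  rewrite opprD addrACA; apply: subgroupD => //; apply: subgroup_subC => //;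
  exact: rf.
have mulA : associative mul.
  move=> i j k; rewrite -[i]fr -[j]fr -[k]fr -!fD ?addrA //; exact: subgroupD.
have mul1 : left_id one mul by move=> i; rewrite -[i]fr -fD // add0r.
have mulV : left_inverse one inv mul.
  by move=> i; rewrite /inv -[i in mul _ i]fr -fD ?addNr //; apply: subgroupN.
pose gT : finGroupType :=
  HB.pack 'I_n (Finite_isGroup.Build 'I_n mulA mul1 mulV).
exists gT, (f : M -> gT); split=> [|x k Gx|x Gx|y].
- by rewrite cardsT card_ord.
- elim: k => [|k IHk]; first by rewrite mulr0n expg0.
  by rewrite mulrS expgS -IHk; apply: fD => //; apply: subgroupMn.
- by have := fH x 0 Gx G0; rewrite subr0.
- by exists (r y).
Qed.

Lemma has_index_exponent G H n x : subgroup G -> subgroup H ->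
  has_index G H n -> G x -> H (x *+ n).
Proof.
move=> sG sH /(has_index_quotient sG sH)[gT [g [cG gX gH _]]] Gx.
apply/gH; first exact: subgroupMn.
by rewrite gX // -[X in (_ ^+ X)%g]cG expg_cardG // inE.
Qed.

Lemma has_index_Cauchy G H n q : subgroup G -> subgroup H -> has_index G H n ->
  prime q -> (q %| n)%N -> exists x, [/\ G x, ~ H x & H (x *+ q)].
Proof.
move=> sG sH /(has_index_quotient sG sH)[gT [g [cG gX gH gsurj]]] q_pr qn.
have [||y _ oy] := @Cauchy gT q [set: gT]%G => //; first by rewrite cG.
have [x Gx gx] := gsurj y; exists x; split=> //.
  by move/gH; rewrite gx => /(_ Gx) y1; move: q_pr; rewrite -oy y1 order1.
by apply/gH; [exact: subgroupMn|rewrite gX // gx -oy expg_order].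
Qed.

(** For a common prime divisor [q] of [n] and [k], Cauchy's theorem gives an element of order [q] in
    [G / H]. It is also killed by [m], which is prime to [q]: a contradiction. *)
Lemma has_index_coprime G H m n k : subgroup G -> subgroup H ->
  has_index G H n -> (forall x, G x -> H (x *+ m)) -> coprime m k -> coprime n k.
Proof.
move=> sG sH Gn mH cmk; apply/negPn/negP => nck.
have n0 := has_index_gt0 Gn.
have g1 : (1 < gcdn n k)%N.
  by rewrite ltn_neqAle eq_sym nck gcdn_gt0 n0.
have q_pr := pdiv_prime g1; set q := pdiv _ in q_pr.
have : (q %| gcdn n k)%N := pdiv_dvd _.
rewrite dvdn_gcd => /andP[qn qk].
have [x [Gx nHx Hqx]] := has_index_Cauchy sG sH Gn q_pr qn.
apply: nHx; apply: subgroup_coprime (mH _ Gx) Hqx => //.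
rewrite coprime_sym prime_coprime //; apply: contraL cmk => qm.
rewrite /coprime; apply: contraTneq (prime_gt1 q_pr) => g.
by rewrite -leqNgt dvdn_leq // -g dvdn_gcd qm.
Qed.

End Index.

(** * Isomorphic quotients have the same index *)

Section IndexIso.
Variables (M M' : zmodType) (f : M -> M') (G H : set M) (G' H' : set M').
Hypotheses (sG' : subgroup G') (sH' : subgroup H').
Hypothesis fB : forall x y, G x -> G y -> f (x - y) = f x - f y.
Hypothesis sG : subgroup G.
Hypothesis fG : forall x, G x -> G' (f x).
Hypothesis fH : forall x, G x -> H x <-> H' (f x).
Hypothesis fsurj : forall y, G' y -> exists x, G x /\ H' (y - f x).

(** Surjectivity is only required modulo [H'], so that taking [f] to be the identity yields the
    second isomorphism theorem. *)
Lemma has_index_iso n : has_index G H n <-> has_index G' H' n.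
Proof.
split=> -[g [gH gG]].
  have /choice[r rP] y : exists x, G' y -> G x /\ H' (y - f x).
    by have [/fsurj[x ?]|nG] := pselect (G' y); [exists x|exists 0].
  exists (g \o r); split=> [x y /= /[dup] G'x /rP[Gx Hx] /[dup] G'y /rP[Gy Hy]|i].
    rewrite gH // fH; last exact: subgroupB.
    rewrite fB //; split=> h.
      rewrite -[x](subrK (f (r x))) -[y](subrK (f (r y))) opprD addrACA.
      by apply: subgroupD => //; apply: subgroupB.
    rewrite (_ : f (r x) - f (r y) = (x - y) - ((x - f (r x)) - (y - f (r y)))).
      by apply: subgroupB => //; apply: subgroupB.
    apply/esym/(canLR (addrK _)); rewrite addrACA -opprD.
    by rewrite [f (r x) + _]addrC [f (r y) + _]addrC !subrK.
  have [x Gx gx] := gG i; exists (f x); first exact: fG.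
  have [Grx Hx] := rP _ (fG Gx); rewrite -gx /=; apply/gH => //.
  apply/fH; first exact: subgroupB.
  by rewrite fB //; apply: subgroup_subC.
exists (g \o f); split=> [x y Gx Gy /=|i].
  by rewrite gH ?fH -?fB //; [exact: subgroupB|exact: fG|exact: fG].
have [y G'y <-] := gG i; have [x [Gx Hx]] := fsurj G'y.
by exists x => //=; apply/gH => //; [exact: fG|exact: subgroup_subC].
Qed.
End IndexIso.

(** * Ideals and the labelling of their cosets *)

Section Ideals.
Variable R : pzRingType.
Implicit Types S I : set R.

Lemma ideal_subgroup S I : ideal_of S I -> subgroup I.
Proof. by case. Qed.

(** Two cosets coincide exactly when their representatives differ by an element of [I]. A bijection
    from the cosets onto the integers below [n] is thus the same as a labelling. *)
Lemma cosets_has_index S I n : subgroup S -> subgroup I -> I `<=` S ->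
  (cosets S I #= `I_n)%card <-> has_index S I n.
Proof.
move=> sS sI IS.
have cE x y : ([set x + z | z in I] = [set y + z | z in I]) <-> I (x - y).
  split=> [e|Ixy].
    have : [set x + z | z in I] x by exists 0; rewrite ?addr0 //; case: sI.
    by rewrite e => -[z Iz <-]; rewrite addrAC subrr add0r.
  apply/seteqP; split=> _ [z Iz <-].
    exists (x - y + z); first exact: subgroupD.
    by rewrite addrA addrCA subrr addr0.
  exists (z - (x - y)); first exact: subgroupB.
  by rewrite opprB addrCA [x + _]addrC addrNK addrC.
split=> [/card_set_bijP[h [hn hinj hsurj]]|[f [fI fS]]].
  have n0 : (0 < n)%N.
    have : cosets S I [set 0 + z | z in I] by exists 0; case: sS.
    by move=> /hn; exact: leq_trans.
  pose f x : 'I_n := insubd (Ordinal n0) (h [set x + z | z in I]).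
  have fE x : S x -> f x = h [set x + z | z in I] :> nat.
    move=> Sx; rewrite val_insubd ifT //.
    by apply: hn; exists x.
  exists f; split=> [x y Sx Sy|i].
    split=> [/(congr1 val)|/cE e].
      rewrite /= !fE // => /hinj; rewrite !inE => e; apply/cE/e.
        by exists x.
      by exists y.
    by apply: val_inj; rewrite /= !fE // e.
  have [_ [x Sx <-] hx] := hsurj i (ltn_ord i).
  by exists x => //; apply: val_inj; rewrite /= fE.
rewrite card_eq_sym; apply/card_set_bijP.
have /choice[r rP] : forall i, exists x, (i < n)%N -> S x /\ f x = i :> nat.
  move=> i; have [lt_i|nlt] := boolP (i < n)%N; last by exists 0.
  by have [x Sx fx] := fS (Ordinal lt_i); exists x => _; rewrite fx.
exists (fun i => [set r i + z | z in I]); split.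
- by move=> i /= lt_i; exists (r i) => //; have [] := rP i lt_i.
- move=> i j; rewrite !inE /= => li lj /cE.
  have [Si fi] := rP i li; have [Sj fj] := rP j lj.
  by move=> /(fI _ _ Si Sj)/(congr1 val); rewrite /= fi fj.
- move=> _ [x Sx <-]; exists (f x) => /=; first exact: ltn_ord.
  have [Sr fr] := rP (f x) (ltn_ord _).
  by apply/cE/fI => //; apply: val_inj.
Qed.

Lemma ideals_of_indexP S I n : subgroup S ->
  ideals_of_index S n I <-> ideal_of S I /\ has_index S I n.
Proof.
move=> sS; split=> -[iI h]; split=> //; move: h;
 by rewrite (cosets_has_index n sS (ideal_subgroup iI)) //; case: iI.
Qed.

End Ideals.

(** * Counting ideals of a given index *)

Section FiniteCount.

(** On an infinite set the value is [0], whence the finiteness hypotheses in what follows. *)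
Definition ncard (T : choiceType) (A : set T) := #|` fset_set A|%fset.

Lemma ncard_eq (T U : choiceType) (A : set T) (B : set U) (f : T -> U) :
  finite_set A -> set_bij A B f -> ncard A = ncard B.
Proof.
move=> fA [fun_f inj_f surj_f].
have -> : B = f @` A by apply/seteqP; split=> [//|_ [x Ax <-]]; apply: fun_f.
rewrite /ncard fset_set_image // card_in_imfset //= => x y.
by rewrite !in_fset_set //; apply: inj_f.
Qed.

Lemma ncardX (T U : choiceType) (A : set T) (B : set U) :
  finite_set A -> finite_set B -> ncard (A `*` B) = (ncard A * ncard B)%N.
Proof.
move=> fA fB; rewrite /ncard fset_setX // -(size_allpairs pair).
apply/perm_size/uniq_perm; first by rewrite fset_uniq.
  by apply: allpairs_uniq; rewrite ?fset_uniq // => -[x y] [x' y'] _ _ [-> ->].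
move=> [x y]; rewrite in_fsetM /=; apply/andP/allpairsP => [[Ax By]|].
  by exists (x, y).
by move=> [[x' y'] [/= Ax By [-> ->]]].
Qed.

Lemma ncardU (T : choiceType) (A B : set T) : finite_set A -> finite_set B ->
  A `&` B = set0 -> ncard (A `|` B) = (ncard A + ncard B)%N.
Proof.
move=> fA fB AB; rewrite /ncard fset_setU //.
by rewrite cardfsU -fset_setI // AB fset_set0 cardfs0 subn0.
Qed.
End FiniteCount.

(** A group between [K] and [G] is a union of cosets of [K], hence is determined by a set of
    labels. *)
Lemma finite_overgroups (M : zmodType) (G K : set M) n :
  has_index G K n -> finite_set [set H | [/\ subgroup H, K `<=` H & H `<=` G]].
Proof.
move=> [f [fK _]].
pose g (t : {set 'I_n}) := [set x | G x /\ f x \in t].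
apply: sub_finite_set (finite_image g (finite_finset (X := setT))).
move=> H [sH KH HG] /=.
exists [set i | `[< exists2 x, H x & f x = i >]]%SET => //.
apply/seteqP; split=> x /=; last first.
  by move=> Hx; split; [exact: HG|rewrite inE; apply/asboolP; exists x].
move=> [Gx]; rewrite inE => /asboolP[y Hy /(fK _ _ (HG _ Hy) Gx)/KH Hyx].
by rewrite -[x](subKr y); apply: subgroupB.
Qed.

Section IdealCount.
Variable R : pzRingType.
Implicit Types S I : set R.

Lemma ideal_setI S I J : ideal_of S I -> ideal_of S J -> ideal_of S (I `&` J).
Proof.
move=> [IS I0 IB IM] [JS J0 JB JM]; split=> //.
- by move=> x [/IS].
- by move=> x y [Ix Jx] [Iy Jy]; split; [exact: IB|exact: JB].
move=> r x Sr [Ix Jx].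
by have [? ?] := IM r x Sr Ix; have [? ?] := JM r x Sr Jx.
Qed.

(* The inverse bijection sends [I] to [(I : n)] and [(I : m)]. *)
Lemma ideals_of_index_mul S m n :
    (forall x y, S x -> S y -> S (x * y)) -> subgroup S -> coprime m n ->
    (0 < m)%N -> (0 < n)%N ->
    finite_set (ideals_of_index S m) -> finite_set (ideals_of_index S n) ->
  ncard (ideals_of_index S (m * n)) =
    (ncard (ideals_of_index S m) * ncard (ideals_of_index S n))%N.
Proof.
move=> SM sS cmn m0 n0 fm fn; rewrite -ncardX //; apply/esym.
have cnm : coprime n m by rewrite coprime_sym.
have [u [v uv]] := coprime_decomp R cmn.
(* By Bezout every [x] in [S] is the sum of a multiple of [m x], in [I], and a multiple of [n x], in
   [J]. Hence [I / (I & J)] is isomorphic to [S / J]. *)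
have comax I J : ideal_of S I -> ideal_of S J ->
    (forall x, S x -> I (x *+ m)) -> (forall x, S x -> J (x *+ n)) ->
    forall l, has_index S J l -> has_index I (I `&` J) l.
  move=> iI iJ mI nJ l; have [IS _ _ _] := iI.
  have [sI sJ] := (ideal_subgroup iI, ideal_subgroup iJ).
  apply: (has_index_iso (f := id) sJ (fun _ _ _ _ => erefl) sI IS _ _ l).2 => // x.
    by move=> Ix; split=> [[]|].
  move=> Sx; exists (x *+ m *~ u); split.
    by apply: subgroupMz => //; exact: mI.
  by rewrite /= {1}(uv x) addrAC subrr add0r; apply: subgroupMz => //; exact: nJ.
have expo I k : ideals_of_index S k I -> forall x, S x -> I (x *+ k).
  move=> /(ideals_of_indexP _ _ sS)[iI Ik] x Sx.
  by apply: has_index_exponent Ik Sx => //; exact: ideal_subgroup iI.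
apply: (ncard_eq (f := fun P => P.1 `&` P.2)); first exact: finite_setX.
split.
- move=> [I J] [/= Im Jn]; have := (expo _ _ Im, expo _ _ Jn).
  move: Im Jn; rewrite !ideals_of_indexP // => -[iI Im] [iJ Jn] [mI nJ].
  split; first exact: ideal_setI.
  apply: (has_index_tower sS (ideal_subgroup iI)) Im (comax _ _ iI iJ mI nJ _ Jn).
  + exact: ideal_subgroup (ideal_setI iI iJ).
  + by case: iI.
  + exact: subIsetl.
(* Multiplication by [l] is injective modulo [I], because [k] kills [S / I] and is prime to [l]. So
   the intersection determines [I]. *)
- have rec I J k l : coprime k l ->
      ideals_of_index S k I -> ideals_of_index S l J ->
      I = [set x | S x /\ (I `&` J) (x *+ l)].
    move=> ckl Ik Jl; have := (expo _ _ Ik, expo _ _ Jl).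
    move: Ik Jl; rewrite !ideals_of_indexP // => -[iI Ik] [iJ Jl] [kI lJ].
    have sI := ideal_subgroup iI; have [IS _ _ _] := iI.
    apply/seteqP; split=> x /=; last first.
      by move=> [Sx [Ix _]]; apply: (subgroup_coprime sI ckl) => //; apply: kI.
    move=> Ix; split; first exact: IS.
    by split; [exact: subgroupMn|apply/lJ/IS].
  move=> [I J] [I' J']; rewrite !inE => -[/= Im Jn] [/= Im' Jn'] e; congr (_, _).
    by rewrite (rec I J m n) // (rec I' J' m n) // e.
  by rewrite (rec J I n m) // (rec J' I' n m) // setIC e setIC.
move=> I /(ideals_of_indexP _ _ sS)[iI Imn].
have sI := ideal_subgroup iI; have [IS I0 IB IM] := iI.
have colon k : ideal_of S [set x | S x /\ I (x *+ k)].
  split=> [x []//| |x y [Sx Ix] [Sy Iy]|r x Sr [Sx Ix]].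
  - by split; [case: sS|rewrite mul0rn].
  - by split; [exact: subgroupB|rewrite mulrnBl; apply: IB].
  - by have [? ?] := IM r _ Sr Ix; split; (split; [exact: SM|]);
      [rewrite -mulrnAr|rewrite -mulrnAl].
pose I1 := [set x | S x /\ I (x *+ n)]; pose I2 := [set x | S x /\ I (x *+ m)].
have I12 : I1 `&` I2 = I.
  apply/seteqP; split=> x /=.
    by move=> [[Sx In] [_ Im]]; apply: subgroup_coprime cmn Im In.
  by move=> Ix; split; (split; [exact: IS|exact: subgroupMn]).
have mnI x : S x -> I (x *+ (m * n)) by move=> Sx; apply: has_index_exponent Imn Sx.
have mI1 x : S x -> I1 (x *+ m).
  by move=> Sx; split; [exact: subgroupMn|rewrite -mulrnA; apply: mnI].
have nI2 x : S x -> I2 (x *+ n).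
  by move=> Sx; split; [exact: subgroupMn|rewrite -mulrnA mulnC; apply: mnI].
have [iI1 iI2] : ideal_of S I1 /\ ideal_of S I2 by split; apply: colon.
have [sI1 sI2] := (ideal_subgroup iI1, ideal_subgroup iI2).
have [I1S II1] : I1 `<=` S /\ I `<=` I1 by split=> x; rewrite -?I12 => -[].
have [I2S II2] : I2 `<=` S /\ I `<=` I2 by split=> x; rewrite -?I12 => -[].
have [m1 [_ [Im1 _ _]]] := has_index_split sS sI1 sI I1S II1 Imn.
have [n1 [_ [In1 _ _]]] := has_index_split sS sI2 sI I2S II2 Imn.
(* The indices of the two colon ideals have product [m * n], while [m1] is prime to [n] and [n1] to
   [m]. This forces [m1 = m] and [n1 = n]. *)
have e : (m1 * n1)%N = (m * n)%N.
  apply: has_index_uniq Imn; rewrite -I12.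
  apply: (has_index_tower sS sI1 _ I1S _ Im1); rewrite ?I12 // -I12.
  exact: comax In1.
have cm1 : coprime m1 n := has_index_coprime sS sI1 Im1 mI1 cmn.
have cn1 : coprime n1 m := has_index_coprime sS sI2 In1 nI2 cnm.
have em : m1 = m.
  apply/eqP; rewrite eqn_dvd -(Gauss_dvdl m cm1) -e dvdn_mulr //=.
  by rewrite coprime_sym in cn1; rewrite -(Gauss_dvdl m1 cn1) e dvdn_mulr.
have en : n1 = n.
  by move: e; rewrite em => /eqP; rewrite eqn_pmul2l // => /eqP.
exists (I1, I2) => //.
by split; apply/(ideals_of_indexP _ _ sS); rewrite /= -?em -?en.
Qed.

Definition subring S := [/\ S 1, forall x y, S x -> S y -> S (x - y)
  & forall x y, S x -> S y -> S (x * y)].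

Lemma subring_subgroup S : subring S -> subgroup S.
Proof. by move=> [S1 SB SM]; split=> //; rewrite -(subrr 1); apply: SB. Qed.

(* The inverse of contraction [I |-> I `&` S] is [I |-> (I : c)]. *)
Lemma ideals_of_index_contract S S' c q : subring S -> subring S' -> S `<=` S' ->
    (forall x, S' x -> S (x *+ c)) -> coprime c q ->
    finite_set (ideals_of_index S' q) ->
  ncard (ideals_of_index S' q) = ncard (ideals_of_index S q).
Proof.
move=> rS rS' SS' cS' ccq fin.
have [sS sS'] := (subring_subgroup rS, subring_subgroup rS').
have [[_ _ SM] [_ _ SM']] := (rS, rS').
have cqc : coprime q c by rewrite coprime_sym.
have [u [v uv]] := coprime_decomp R ccq.
have expo T I : subgroup T -> ideals_of_index T q I -> forall x, T x -> I (x *+ q).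
  move=> sT /(ideals_of_indexP _ _ sT)[iI Ik] x Tx.
  by apply: has_index_exponent Ik Tx => //; exact: ideal_subgroup iI.
apply: (ncard_eq (f := fun I => I `&` S)) => //; split.
- move=> I Iq; have qI := expo _ _ sS' Iq.
  move: Iq; rewrite !ideals_of_indexP // => -[iI Iq].
  have sI := ideal_subgroup iI; have [IS I0 IB IM] := iI; split.
    split=> [x []//| |x y [Ix Sx] [Iy Sy]|r x Sr [Ix Sx]].
    + by split=> //; case: sS.
    + by split; [exact: IB|exact: subgroupB].
    + have [? ?] := IM r x (SS' _ Sr) Ix.
      by split; (split; [|exact: SM]).
  (* Since [c] maps [S'] into [S] and [q] maps it into [I], Bezout gives [S' = S + I]. So
     [S / (I & S)] is isomorphic to [S' / I]. *)
  have iso := has_index_iso (f := id) sI (fun _ _ _ _ => erefl) sS SS'.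
  apply: (iso _ _ _ q).2 Iq => // [x Sx|y Sy].
  + by split=> [[]|].
  + exists (y *+ c *~ u); split; first by apply: subgroupMz => //; exact: cS'.
    by rewrite /= {1}(uv y) addrAC subrr add0r; apply: subgroupMz => //; exact: qI.
- have rec I : ideals_of_index S' q I -> I = [set x | S' x /\ (I `&` S) (x *+ c)].
    move=> Iq; have qI := expo _ _ sS' Iq.
    move: Iq; rewrite !ideals_of_indexP // => -[iI Iq].
    have sI := ideal_subgroup iI; have [IS _ _ _] := iI.
    apply/seteqP; split=> x /=.
      move=> Ix; split; first exact: IS.
      by split; [exact: subgroupMn|apply/cS'/IS].
    by move=> [Sx [Ix _]]; apply: (subgroup_coprime sI ccq) => //; apply: qI.
  by move=> I J; rewrite !inE => Iq Jq e; rewrite (rec I) // (rec J) // e.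
move=> I Iq; have qI := expo _ _ sS Iq.
move: Iq; rewrite !ideals_of_indexP // => -[iI Iq].
have sI := ideal_subgroup iI; have [IS I0 IB IM] := iI.
pose J := [set x | S' x /\ I (x *+ c)].
have iJ : ideal_of S' J.
  split=> [x []//| |x y [Sx Ix] [Sy Iy]|r x Sr [Sx Ix]].
  - by split; [case: sS'|rewrite mul0rn].
  - by split; [exact: subgroupB|rewrite mulrnBl; apply: IB].
  (* As [r] lies only in [S'], the ideal property of [I] is applied to [r *+ c]. The surplus factor
     [c] is then removed, since [q] times an element of [S] lies in [I]. *)
  - split; (split; first exact: SM'); apply: (subgroup_coprime sI ccq).
    + by rewrite -mulrnAr -mulrnAl; have [] := IM _ _ (cS' _ Sr) Ix.
    + by apply/qI/cS'/SM'.
    + by rewrite -mulrnAl -mulrnAr; have [] := IM _ _ (cS' _ Sr) Ix.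
    + by apply/qI/cS'/SM'.
have sJ := ideal_subgroup iJ.
have JI : J `&` S = I.
  apply/seteqP; split=> x /=.
    by move=> [[Sx Ix] S_x]; apply: (subgroup_coprime sI ccq Ix); apply: qI.
  by move=> Ix; split; [split; [exact/SS'/IS|exact: subgroupMn]|exact: IS].
exists J => //; apply/(ideals_of_indexP _ _ sS'); split=> //.
have iso := has_index_iso (f := id) sJ (fun _ _ _ _ => erefl) sS SS'.
apply: (iso _ _ _ q).1 Iq => // x.
- by move=> Sx; rewrite -JI; split=> [[]|].
move=> Sx; exists (x *+ c *~ u); split.
  by apply: subgroupMz => //; exact: cS'.
rewrite /= {1}(uv x) addrAC subrr add0r; apply: subgroupMz => //; split.
  exact: subgroupMn.
by rewrite -mulrnA mulnC mulrnA; apply/qI/cS'.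
Qed.

End IdealCount.

(** * Subrings of [Z^d] *)

Definition shift (f : nat -> int) k := if k is j.+1 then f j else 0.

(** On generating series in [T] this is multiplication by [1 - T], and [shift] is multiplication by
    [T]. For [T = p^-s] it cancels the Euler factor of [riemann_zeta] at [p]. *)
Definition bdiff f k := f k - shift f k.

Lemma iter_bdiffB n f g : iter n bdiff (fun k => f k - g k) =
  (fun k => iter n bdiff f k - iter n bdiff g k).
Proof.
elim: n f g => [|n IHn] f g //; rewrite !iterSr -IHn; congr (iter n bdiff _).
by apply/funext => -[|k]; rewrite /bdiff /=; lia.
Qed.

Lemma iter_bdiff_shift n f : iter n bdiff (shift f) = shift (iter n bdiff f).
Proof.
elim: n f => [|n IHn] f //; rewrite !iterSr -IHn; congr (iter n bdiff _).
by apply/funext => -[|[|k]]; rewrite /bdiff /=; lia.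
Qed.

Section Lattice.

Variable d : nat.
Notation Zd := {ffun 'I_d -> int}.
Implicit Types (x y v : Zd) (S I J : set Zd).

Lemma ffun_mulE x y i : (x * y) i = x i * y i.
Proof. exact: ffunE. Qed.

Lemma ffun_mulrnE x n i : (x *+ n) i = x i *+ n.
Proof. by elim: n => [|n IHn]; rewrite ?mulr0n ?mulrS ffunE ?IHn. Qed.

Lemma ffun_mulrzE x (m : int) i : (x *~ m) i = x i *~ m.
Proof.
case: m => n; first by rewrite -!pmulrn ffun_mulrnE.
by rewrite NegzE !mulrNz -!pmulrn ffunE ffun_mulrnE.
Qed.

Lemma ffun_subE x y i : (x - y) i = x i - y i.
Proof. by rewrite !ffunE. Qed.

Lemma ffun0E i : (0 : Zd) i = 0.
Proof. exact: ffunE. Qed.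

Definition ZdE := (ffun_mulE, ffun_subE, ffun0E, ffun_mulrnE, ffun_mulrzE).

Lemma ffun_mulCA x y z : x * (y * z) = y * (x * z).
Proof. by apply/ffunP => i; rewrite !ZdE mulrCA. Qed.

Lemma subgroup_setT : subgroup [set: Zd].
Proof. by []. Qed.

(** Lattices of known index, against which other subgroups are measured. *)
Definition box (t : 'I_d -> nat) : set Zd :=
  [set x | forall i, ((t i)%:Z %| x i)%Z].

Lemma subgroup_box t : subgroup (box t).
Proof.
split=> [i|x y Bx By i]; rewrite !ZdE ?dvdz0 //.
by apply: rpredB; [exact: Bx|exact: By].
Qed.

Lemma has_index_box t : (forall i, 0 < t i)%N ->
  has_index setT (box t) (\prod_i t i).
Proof.
move=> t0.
have -> : (\prod_i t i)%N = #|{dffun forall i : 'I_d, 'I_(t i)}|.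
  rewrite card_dep_ffun foldrE big_map big_enum /=.
  by apply: eq_bigr => i _; rewrite card_ord.
have lt_mod (z : int) i : (`|(z %% (t i)%:Z)%Z|%N < t i)%N.
  have := ltz_mod z (d := (t i)%:Z); have := modz_ge0 z (d := (t i)%:Z).
  have := t0 i; rewrite -lt0n; lia.
pose T := {dffun forall i : 'I_d, 'I_(t i)}; pose f (x : Zd) : T :=
  [ffun i => Ordinal (lt_mod (x i) i)].
apply: (has_index_label (f := f)) => [x y _ _|u].
  split=> [fxy i|Bxy].
    have /(congr1 val) := congr1 (fun g : T => g i) fxy.
    rewrite !ffunE /= => e; rewrite -eqz_mod_dvd; apply/eqP.
    have := modz_ge0 (x i) (d := (t i)%:Z); have := modz_ge0 (y i) (d := (t i)%:Z).
    have := t0 i; lia.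
  apply/ffunP => i; rewrite !ffunE; apply: val_inj => /=; congr (`|_|%N).
  by apply/eqP; rewrite eqz_mod_dvd -ffun_subE; exact: Bxy.
exists [ffun i => (u i)%:Z] => //; apply/ffunP => i; rewrite !ffunE.
by apply: val_inj; rewrite /= modz_nat modn_small.
Qed.

Section Conductor.
Variables (S : set Zd) (N : nat).
Hypotheses (rS : subring S) (N0 : (0 < N)%N) (condS : forall x, S (x *+ N)).

Let sS := subring_subgroup rS.

Lemma conductor_ideal n I x : ideals_of_index S n I -> I (x *+ (N * n)).
Proof.
move=> /(ideals_of_indexP _ _ sS)[iI In].
rewrite mulrnA; apply: has_index_exponent In _ => //.
exact: ideal_subgroup iI.
Qed.

Lemma box_mulrn n x : box (fun=> n) x -> exists y, x = y *+ n.
Proof.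
move=> Bx; exists [ffun i => (x i %/ n)%Z]; apply/ffunP => i.
by rewrite ZdE ffunE -mulr_natr natz divzK.
Qed.

(** All these ideals contain [N n Z^d], as [N Z^d] lies in [S] and [n] kills the quotient. Only
    finitely many groups lie above this lattice. *)
Lemma finite_ideals n : (0 < n)%N -> finite_set (ideals_of_index S n).
Proof.
move=> n0; pose t (i : 'I_d) := (N * n)%N.
have t0 i : (0 < t i)%N by rewrite /t muln_gt0 N0.
apply: sub_finite_set (finite_overgroups (has_index_box t0)) => I In.
split=> //; first by case/(ideals_of_indexP _ _ sS): In => /ideal_subgroup.
by move=> x /box_mulrn[y ->]; apply: conductor_ideal.
Qed.

Lemma conductor_index : exists D, has_index setT S D.
Proof.
have t0 (i : 'I_d) : (0 < N)%N by [].
have [||D [_ [SD _ _]]] :=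
  has_index_split subgroup_setT sS (subgroup_box (fun=> N)) _ _ (has_index_box t0).
- by [].
- by move=> x /box_mulrn[y ->].
by exists D.
Qed.

End Conductor.

Definition dil (p : nat) (i : 'I_d) : Zd := [ffun j => if j == i then p%:Z else 1].

Lemma dil_inj p i : (0 < p)%N -> injective ( *%R (dil p i)).
Proof.
move=> p0 x y /ffunP e; apply/ffunP => j; have := e j; rewrite !ZdE ffunE.
case: eqP => _; last by rewrite !mul1r.
by apply: mulfI; lia.
Qed.

Lemma dil_subgroup p i I : subgroup I -> subgroup [set dil p i * v | v in I].
Proof.
move=> [I0 IB]; split; first by exists 0 => //; rewrite mulr0.
by move=> _ _ [x Ix <-] [y Iy <-]; exists (x - y); [exact: IB|rewrite mulrBr].
Qed.

Lemma has_index_dilT p i : (0 < p)%N ->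
  has_index setT [set dil p i * v | v in setT] p.
Proof.
move=> p0; pose t j := if j == i then p else 1%N.
have -> : [set dil p i * v | v in setT] = box t.
  apply/seteqP; split=> [_ [v _ <-] j|x Bx].
    by rewrite ZdE ffunE /t; case: eqP => _; [exact: dvdz_mulr|exact: dvd1z].
  exists [ffun j => (x j %/ (t j)%:Z)%Z] => //.
  apply/ffunP => j; rewrite ZdE !ffunE.
  have := Bx j; rewrite /t; case: eqP => _ dx; first by rewrite mulrC divzK.
  by rewrite mul1r divz1.
rewrite -[X in has_index _ _ X](_ : (\prod_j t j)%N = p).
  by apply: has_index_box => j; rewrite /t; case: ifP.
rewrite (bigD1 i) //= /t eqxx big1 ?muln1 // => j /negPf -> //.
Qed.

(** The dilation maps [Z^d / I] isomorphically onto the quotient of its image by the dilated [I],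
    and this image has index [p]. Indices are taken in [Z^d] because [S] itself need not be stable
    under dilation. *)
Lemma has_index_dil p i I n : (0 < p)%N -> subgroup I ->
  has_index setT I n <-> has_index setT [set dil p i * v | v in I] (p * n).
Proof.
move=> p0 sI.
have sD := dil_subgroup p i; have pT := has_index_dilT i p0.
have DT : [set dil p i * v | v in I] `<=` [set dil p i * v | v in setT].
  by move=> _ [v Iv <-]; exists v.
have iso m : has_index setT I m <->
    has_index [set dil p i * v | v in setT] [set dil p i * v | v in I] m.
  apply: (has_index_iso (f := *%R (dil p i)) (sD _ sI)
    (fun x y _ _ => mulrBr _ x y) subgroup_setT).
  - by move=> x _; exists x.
  - by move=> x _; split=> [|[y Iy /(dil_inj p0) <-//]]; exists x.
  - move=> _ [v _ <-]; exists v; rewrite subrr; split=> //.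
    by exists 0; rewrite ?mulr0 //; case: sI.
rewrite iso; split=> [h|h].
  by apply: has_index_tower pT h => //; apply: sD.
have [||m [l [hm hl e]]] :=
  has_index_split subgroup_setT (sD _ subgroup_setT) (sD _ sI) _ _ h.
- by [].
- by [].
have mp := has_index_uniq hm pT; move: e; rewrite mp => /eqP.
by rewrite eqn_pmul2l // => /eqP <-.
Qed.

(** * The local case: [S] contains [p ^ e0] times [Z^d] *)

Section Local.
Variables (p e0 : nat) (S : set Zd).
Hypotheses (p_pr : prime p) (rS : subring S) (condS : forall x, S (x *+ p ^ e0)).

Let sS := subring_subgroup rS.
Let p0 : (0 < p)%N := prime_gt0 p_pr.
Let pe0 : (0 < p ^ e0)%N. Proof. by rewrite expn_gt0 p0. Qed.

(** The content of [I] at [i] is the largest such [e]. *)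
Definition content_ge (e : nat) (i : 'I_d) I :=
  forall v, I v -> (((p ^ e)%N)%:Z %| v i)%Z.

(* The content at [i] is at most [e0] for [i \in U], and less than [e0] if
   moreover [i \in W]; in all uses [W \subset U]. *)
Definition bounded_ideals (U W : {set 'I_d}) (k : nat) : set (set Zd) :=
  [set I | ideals_of_index S (p ^ k) I /\
    forall i, i \in U -> ~ content_ge (e0 + (i \notin W)) i I].

Lemma finite_bounded_ideals U W k : finite_set (bounded_ideals U W k).
Proof.
apply: sub_finite_set (finite_ideals rS pe0 condS (n := p ^ k) _) => [I []//|].
by rewrite expn_gt0 p0.
Qed.

(** Indices in [S] and in [Z^d] differ by the constant factor [D], which makes the effect of a
    dilation on them computable. *)
Lemma index_total D I n : has_index setT S D -> subgroup I -> I `<=` S ->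
  has_index S I n <-> has_index setT I (D * n).
Proof.
move=> SD sI IS; split=> [h|h]; first exact: has_index_tower SD h.
have [//|m [l [hm hl e]]] := has_index_split subgroup_setT sS sI _ IS h.
have mD := has_index_uniq hm SD; move: e; rewrite mD => /eqP.
by rewrite eqn_pmul2l ?(has_index_gt0 SD) // => /eqP <-.
Qed.

Lemma bounded_ideals_all W k I : bounded_ideals [set: 'I_d]%SET W k I ->
  (k + #|W| <= 2 * d * e0)%N.
Proof.
move=> [Ik cI].
have := Ik => /(ideals_of_indexP _ _ sS)[iI hI].
have sI := ideal_subgroup iI; have [IS I0 IB IM] := iI.
(* If [e0 = 0], no content is less than [e0] and [W] is empty. Hence the truncated subtraction in
   [t] is a true one. *)
have e0W i : i \in W -> (0 < e0)%N.
  move=> iW; rewrite lt0n; apply: contra_notN (cI i _);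
    rewrite ?finset.in_setT // iW addn0.
  by move=> /eqP-> v _; rewrite expn0 dvd1z.
pose t i := (p ^ (e0 + e0 - (i \in W)))%N.
have t0 i : (0 < t i)%N by rewrite expn_gt0 p0.
pose del i : Zd := [ffun j => (j == i)%:R].
have Idel i : I (del i *+ t i).
  have iT : i \in [set: 'I_d]%SET by rewrite finset.in_setT.
  have /existsNP[v /not_implyP[Iv /negP nv]] := cI i iT.
  pose e := logn p `|v i|; pose w := (v i %/ ((p ^ e)%N)%:Z)%Z.
  have vi : v i = w * ((p ^ e)%N)%:Z by rewrite divzK // dvdzE /= pfactor_dvdnn.
  have v0 : v i != 0 by apply: contraNneq nv => ->; rewrite dvdz0.
  have pw : ~~ (p%:Z %| w)%Z.
    rewrite dvdzE /=; apply/negP => pw.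
    have : (p ^ e.+1 %| `|v i|)%N by rewrite vi abszM /= expnS dvdn_mul.
    by rewrite pfactor_dvdn ?absz_gt0 // -/e ltnn.
  have le_e : (e < e0 + (i \notin W))%N.
    rewrite ltnNge; apply: contra nv => le_e.
    by rewrite vi; apply: dvdz_mull; rewrite dvdzE /= dvdn_exp2l.
  (* The part [w] of [v i] prime to [p] is removed, since [p ^ (e0 + k)] maps [Z^d] into [I]. *)
  apply: (subgroup_coprime (m := `|w|) (n := p ^ e0 * p ^ k) sI).
  - by rewrite -expnD coprimeXr // coprime_sym prime_coprime // -dvdzE.
  - have [+ _] := IM _ v (condS (del i)) Iv.
    have -> : del i *+ p ^ e0 * v = del i *~ w *+ (p ^ e0 * p ^ e).
      apply/ffunP => j; rewrite !ZdE ffunE; case: eqP => [->|_].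
        by rewrite vi mulrnAl mul1r intz mulnC mulrnA -[in LHS]natz mulr_natr.
      by rewrite !mul0rn mul0r mul0rz mul0rn.
    move=> /(subgroupMn (p ^ (e0 - (i \in W) - e)) sI).
    rewrite -mulrnA -!expnD (_ : e0 + e + _ = e0 + e0 - (i \in W))%N; last first.
      by move: le_e (@e0W i); case: (i \in W) => /= ? h; [have := h isT|]; lia.
    rewrite -/(t i); case: (w) => a; first by rewrite pmulrn mulrnAC.
    rewrite NegzE mulrNz mulNrn -pmulrn => /(subgroupN sI); rewrite opprK mulrnAC.
    by rewrite abszN.
  - by rewrite mulrnAC; apply: subgroupMn => //; exact: (conductor_ideal rS condS).
have BI : box t `<=` I.
  move=> x Bx.
  have -> : x = \sum_i del i *+ t i *~ (x i %/ (t i)%:Z)%Z.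
    apply/ffunP => j; rewrite sum_ffunE (bigD1 j) //= big1 => [|i ij].
      by rewrite !ZdE ffunE eqxx addr0 mulr1n natz -mulrzr intz mulrC divzK.
    by rewrite !ZdE ffunE eq_sym (negPf ij) mul0rn mul0rz.
  elim/big_ind: _ => // [y z|i _]; first exact: subgroupD.
  by apply: subgroupMz.
have [D SD] := conductor_index rS pe0 condS.
have hT := (index_total (p ^ k) SD sI IS).1 hI.
have := has_index_mono BI hT (has_index_box t0).
rewrite -expn_sum => /(leq_trans (leq_pmull _ (has_index_gt0 SD))).
rewrite leq_exp2l ?prime_gt1 // => le_k.
suff <- : (\sum_i (e0 + e0 - (i \in W)) + #|W| = 2 * d * e0)%N by rewrite leq_add2r.
rewrite -sum1_card [X in (_ + X)%N]big_mkcond -big_split /=.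
rewrite (eq_bigr (fun=> (e0 + e0)%N)) ?sum_nat_const ?card_ord; first by lia.
by move=> i _; case: ifP => [/e0W|_]; lia.
Qed.

(** The difference is zero outside [i], where it is [(p - 1) * v i], so it is a multiple of [p ^ e0]
    in [Z^d]. *)
Lemma conductor_dil i v : ((p ^ e0)%N%:Z %| v i)%Z -> S (dil p i * v - v).
Proof.
move=> dv; rewrite (_ : _ - v =
    [ffun j => (j == i)%:R * ((p%:Z - 1) * (v i %/ (p ^ e0)%N%:Z)%Z)] *+ p ^ e0).
  exact: condS.
apply/ffunP => j; rewrite !ZdE !ffunE; case: eqP => [->|_].
  by rewrite -[in LHS](divzK dv) -[RHS]mulr_natr natz mul1r; ring.
by rewrite !mul1r mul0r mul0rn subrr.
Qed.

(* For [v] with [p ^ e0] dividing [v i], multiplying [v] by [dil p i] changes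
   it by an element of the conductor: this is why multiples stay in [S]. *)
Lemma bounded_ideals_dil_bij i (U W : {set 'I_d}) k : i \notin U -> W \subset U ->
  set_bij (bounded_ideals U W k `&` content_ge e0 i)
    (bounded_ideals U W k.+1 `&` content_ge e0.+1 i)
    (fun I => [set dil p i * v | v in I]).
Proof.
move=> iU WU.
have [D SD] := conductor_index rS pe0 condS.
have D0 := has_index_gt0 SD.
have content_dil e I :
    content_ge e.+1 i [set dil p i * v | v in I] <-> content_ge e i I.
  split=> cI v Iv.
    have := cI _ (imageP _ Iv); rewrite ZdE ffunE eqxx expnS PoszM.
    by rewrite dvdz_mul2l //; lia.
  case: Iv => {}v Iv <-; rewrite ZdE ffunE eqxx expnS PoszM.
  by rewrite dvdz_mul //; apply: cI.
have content_dilN e j I : j != i ->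
    content_ge e j [set dil p i * v | v in I] <-> content_ge e j I.
  move=> ji; split=> cI v Iv.
    by have := cI _ (imageP _ Iv); rewrite ZdE ffunE (negPf ji) mul1r.
  by case: Iv => {}v Iv <-; rewrite ZdE ffunE (negPf ji) mul1r; apply: cI.
have constr I : (forall j, j \in U -> ~ content_ge (e0 + (j \notin W)) j
     [set dil p i * v | v in I]) <->
   (forall j, j \in U -> ~ content_ge (e0 + (j \notin W)) j I).
  have jU j : j \in U -> j != i by apply: contraTneq => ->.
  by split=> cI j Uj /(content_dilN _ _ _ (jU j Uj)); apply: cI.
split.
- move=> I [[/(ideals_of_indexP _ _ sS)[iI Ik] cI] ci].
  have sI := ideal_subgroup iI; have [IS I0 IB IM] := iI.
  split; last exact/content_dil.
  split; last exact/constr.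
  have sJ := dil_subgroup p i sI.
  have JS : [set dil p i * v | v in I] `<=` S.
    move=> _ [v Iv <-]; rewrite -[_ * v](subrK v).
    by apply: subgroupD => //; [apply/conductor_dil/ci|exact: IS].
  apply/(ideals_of_indexP _ _ sS); split.
    case: sJ => J0 JB; split=> // r _ Sr [v Iv <-].
    have [Irv Ivr] := IM r v Sr Iv; split.
      by exists (r * v) => //; rewrite ffun_mulCA.
    by exists (v * r) => //; rewrite mulrA.
  apply/(index_total _ SD) => //.
  rewrite expnS mulnCA; apply/(has_index_dil _ _ p0 sI).
  exact/(index_total _ SD).
- move=> I J _ _ e; apply/seteqP; split=> v Iv.
    have : [set dil p i * v | v in I] (dil p i * v) by exists v.
    by rewrite e => -[w Jw /(dil_inj p0) <-].
  have : [set dil p i * v | v in J] (dil p i * v) by exists v.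
  by rewrite -e => -[w Jw /(dil_inj p0) <-].
move=> J [[/(ideals_of_indexP _ _ sS)[iJ Jk] cJ] ci].
have sJ := ideal_subgroup iJ; have [JS J0 JB JM] := iJ.
(* The preimage of [J]. As [p] divides the [i]-th coordinates of [J], its dilation is all of [J]. *)
pose I := [set v | J (dil p i * v)].
have JI : [set dil p i * v | v in I] = J.
  apply/seteqP; split=> [_ [v Iv <-] //|v Jv].
  have pv : (p%:Z %| v i)%Z.
    by apply: dvdz_trans (ci v Jv); rewrite expnS PoszM dvdz_mulr.
  have vE : dil p i * [ffun j => if j == i then (v j %/ p%:Z)%Z else v j] = v.
    apply/ffunP => j; rewrite ZdE !ffunE.
    by case: eqP => [->|_]; rewrite ?mul1r // mulrC divzK.
  by exists [ffun j => if j == i then (v j %/ p%:Z)%Z else v j]; rewrite /I /= ?vE.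
have ciI : content_ge e0 i I by apply/content_dil; rewrite JI.
have IS : I `<=` S.
  move=> v Iv; rewrite -[v](subKr (dil p i * v)); apply: subgroupB => //.
    exact: JS.
  exact/conductor_dil/ciI.
have sI : subgroup I.
  by split=> [|v w]; rewrite /I /= ?mulr0 // mulrBr; apply: JB.
exists I; last by rewrite JI.
split=> //; split; last by apply/constr; rewrite JI.
apply/(ideals_of_indexP _ _ sS); split.
  case: sI => I0 IB; split=> // r v Sr Iv.
  have [Jrv Jvr] := JM r _ Sr Iv; split; rewrite /I /=.
    by rewrite ffun_mulCA.
  by rewrite mulrA.
apply/(index_total _ SD) => //; apply/(has_index_dil i _ p0 sI); rewrite JI.
by rewrite mulnCA -expnS; apply/(index_total _ SD).
Qed.

Definition bounded_count U W k : int := (ncard (bounded_ideals U W k))%:Z.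

(** The ideals are sorted by whether the content at [i] exceeds [e0]. As [i] is outside [W], adding
    it to [U] alone imposes the complementary condition. *)
Lemma bounded_ideals_split i (U W : {set 'I_d}) k : i \notin U -> W \subset U ->
  ncard (bounded_ideals U W k) = (ncard (bounded_ideals (i |: U) W k) +
    ncard (bounded_ideals U W k `&` content_ge e0.+1 i))%N.
Proof.
move=> iU WU; have iW : i \notin W by apply: contra iU; apply: (fintype.subsetP WU).
have fin := finite_bounded_ideals; rewrite -ncardU //; first last.
- apply/seteqP; split=> // I [[_ /(_ i)]]; rewrite setU11 iW addn1.
  by move=> /(_ isT) + [_].
- exact: finite_setIl.
congr ncard; apply/seteqP; split=> I /=.
  move=> [Ik cI].
  have [ci|ci] := pselect (content_ge e0.+1 i I); [right|left]; split=> //.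
  by move=> j; rewrite in_setU1 => /predU1P[->|]; [rewrite iW addn1|exact: cI].
move=> [[Ik cI]|[]//]; split=> // j Uj; apply: cI.
by rewrite in_setU1 Uj orbT.
Qed.

(** The same sorting with the threshold lowered by one, which is what adding [i] to [W] as well
    expresses. *)
Lemma bounded_ideals_split_strict i (U W : {set 'I_d}) k :
    i \notin U -> W \subset U ->
  ncard (bounded_ideals U W k) = (ncard (bounded_ideals (i |: U) (i |: W) k) +
    ncard (bounded_ideals U W k `&` content_ge e0 i))%N.
Proof.
move=> iU WU.
have fin := finite_bounded_ideals; rewrite -ncardU //; first last.
- apply/seteqP; split=> // I [[_ /(_ i)]]; rewrite !setU11 addn0.
  by move=> /(_ isT) + [_].
- exact: finite_setIl.
have W' j : j \in U -> (j \in i |: W) = (j \in W).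
  by move=> Uj; rewrite in_setU1; case: eqP => // ji; rewrite -ji Uj in iU.
congr ncard; apply/seteqP; split=> I /=.
  move=> [Ik cI].
  have [ci|ci] := pselect (content_ge e0 i I); [right|left]; split=> //.
  move=> j; rewrite in_setU1 => /predU1P[->|Uj]; first by rewrite setU11 addn0.
  by rewrite W' //; apply: cI.
move=> [[Ik cI]|[]//]; split=> // j Uj; rewrite -W' //; apply: cI.
by rewrite in_setU1 Uj orbT.
Qed.

(** An ideal of index [p ^ 0 = 1] contains the unit, whose coordinates are prime to [p]. *)
Lemma bounded_ideals0_content U W i :
  bounded_ideals U W 0 `&` content_ge e0.+1 i = set0.
Proof.
apply/seteqP; split=> // I [[/(ideals_of_indexP _ _ sS)[iI Ik] _]].
have [S1 _ _] := rS.
have : I (1 *+ p ^ 0) := has_index_exponent sS (ideal_subgroup iI) Ik S1.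
rewrite mulr1n => I1 /(_ _ I1); rewrite dvdzE ffunE /= dvdn1 expnS.
by rewrite muln_eq1; have := prime_gt1 p_pr; case: eqP => // ->.
Qed.

(** The count at [k.+1] is split at content [e0.+1], the count at [k] at content [e0]. The parts of
    large content are in bijection by dilation and cancel in the difference. *)
Lemma bdiff_bounded_count i (U W : {set 'I_d}) : i \notin U -> W \subset U ->
  bdiff (bounded_count U W) =
  (fun k => bounded_count (i |: U) W k - shift (bounded_count (i |: U) (i |: W)) k).
Proof.
move=> iU WU; apply/funext => -[|k]; rewrite /bdiff /bounded_count /=.
  rewrite (bounded_ideals_split 0 iU WU) bounded_ideals0_content.
  by rewrite /ncard fset_set0 cardfs0 addn0.
have e := ncard_eq (finite_setIl _ (finite_bounded_ideals U W k))
  (bounded_ideals_dil_bij k iU WU).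
rewrite (bounded_ideals_split k.+1 iU WU) (bounded_ideals_split_strict k iU WU).
by rewrite e; lia.
Qed.

(** Each difference moves one coordinate into [U]. The shifted term is evaluated one step earlier,
    but its [W] has one more element, so [k + #|W|] is preserved: this is why [W] is tracked. Once
    [U] is everything, no ideal is left. *)
Lemma bdiff_bounded_ideals m (U W : {set 'I_d}) k : W \subset U -> #|~: U| = m ->
  (2 * d * e0 < k + #|W|)%N -> iter m bdiff (bounded_count U W) k = 0.
Proof.
elim: m U W k => [|m IHm] U W k WU Um.
  have -> : U = [set: 'I_d]%SET.
    by apply: finset.setC_inj; rewrite finset.setCT; apply: cards0_eq.
  move=> lt_k; have no_ideal : bounded_ideals [set: 'I_d]%SET W k = set0.
    by apply/seteqP; split=> // I /bounded_ideals_all; rewrite leqNgt lt_k.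
  by rewrite /= /bounded_count no_ideal /ncard fset_set0 cardfs0.
have /card_gt0P[i] : (0 < #|~: U|)%N by rewrite Um.
rewrite finset.in_setC => iU lt_k.
rewrite iterSr (bdiff_bounded_count iU WU) iter_bdiffB.
have Um' : #|~: (i |: U)| = m.
  apply/eqP; rewrite -eqSS -Um (cardsD1 i (~: U)) !inE iU.
  by rewrite finset.setCU finset.setIC -finset.setDE.
have iW : i \notin W by apply: contra iU; apply: (fintype.subsetP WU).
rewrite IHm ?(fintype.subset_trans WU) ?finset.subsetUr // sub0r.
case: k lt_k => [|k] lt_k; first by rewrite iter_bdiff_shift oppr0.
rewrite iter_bdiff_shift /= IHm ?oppr0 ?finset.setUS //.
by rewrite cardsU1 iW; lia.
Qed.

Lemma bdiff_ideals_vanish k : (2 * d * e0 < k)%N ->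
  iter d bdiff (fun j => (ncard (ideals_of_index S (p ^ j)))%:Z) k = 0.
Proof.
move=> lt_k.
have -> : (fun j => (ncard (ideals_of_index S (p ^ j)))%:Z) =
    bounded_count finset.set0 finset.set0.
  apply/funext => j; congr (ncard _)%:Z; apply/seteqP; split=> I; last by case.
  by move=> Ij; split=> // i; rewrite finset.inE.
apply: bdiff_bounded_ideals; first exact: finset.sub0set.
  by rewrite finset.setC0 cardsT card_ord.
by rewrite cards0 addn0.
Qed.

End Local.
End Lattice.

(** * From the local case to an arbitrary [N] *)

Section LocalToGlobal.

Variables (d N : nat) (S : set {ffun 'I_d -> int}).
Hypotheses (rS : subring S) (N0 : (0 < N)%N) (condS : forall x, S (x *+ N)).

Lemma bdiff_ideals_vanish_global p k : prime p -> (2 * d * logn p N < k)%N ->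
  iter d bdiff (fun j => (ncard (ideals_of_index S (p ^ j)))%:Z) k = 0.
Proof.
move=> p_pr lt_k; pose c := (N %/ p ^ logn p N)%N.
have Nc : N = (c * p ^ logn p N)%N by rewrite divnK // pfactor_dvdnn.
have cp : coprime p c.
  rewrite prime_coprime //; apply/negP => /dvdnP[m cm].
  have : (p ^ (logn p N).+1 %| N)%N by rewrite {2}Nc cm expnS -mulnA dvdn_mull.
  by rewrite pfactor_dvdn // ltnn.
have sS := subring_subgroup rS; have [S1 SB SM] := rS.
(* This stands in for the localisation of [S] at [p] while remaining inside [Z^d]. As [c] is prime
   to [p], ideals of index a power of [p] are counted alike in [S] and [S']. *)
pose S' := [set x | S (x *+ c)].
have condS' x : S' (x *+ p ^ logn p N) by rewrite /S' /= -mulrnA mulnC -Nc.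
have rS' : subring S'.
  split=> [|x y Sx Sy|x y Sx Sy]; rewrite /S' /=.
  - exact: subgroupMn.
  - by rewrite mulrnBl; apply: SB.
  (* The product of [c x] and [c y] carries one factor [c] too many. It is removed because
     [N = c * p ^ logn p N] maps [Z^d] into [S]. *)
  - apply: (@subgroup_coprime _ _ _ c (p ^ logn p N) sS).
    + by rewrite coprimeXr // coprime_sym.
    + by rewrite -mulrnAr -mulrnAl; apply: SM.
    + by rewrite mulrnAC; apply: condS'.
rewrite -(bdiff_ideals_vanish p_pr rS' condS' lt_k); congr (iter d bdiff _ k).
apply/funext => j; congr _%:Z; apply/esym.
apply: (ideals_of_index_contract (c := c) rS rS') => //.
- by move=> x Sx; apply: subgroupMn.
- by rewrite coprime_sym coprimeXl.
by apply: (finite_ideals rS' _ condS'); rewrite expn_gt0 prime_gt0.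
Qed.

Lemma ideals_of_index1 : ncard (ideals_of_index S 1) = 1%N.
Proof.
have sS := subring_subgroup rS; have [S1 SB SM] := rS.
rewrite (_ : ideals_of_index S 1 = [set S]) /ncard ?fset_set1 ?cardfs1 //.
apply/seteqP; split=> I /=.
  move=> /(ideals_of_indexP _ _ sS)[iI Ik].
  apply/seteqP; split=> [|x Sx]; first by case: iI.
  exact: has_index_exponent sS (ideal_subgroup iI) Ik Sx.
move=> ->; apply/(ideals_of_indexP _ _ sS); split.
  by case: sS => S0 _; split=> // r x Sr Sx; split; apply: SM.
exists (fun=> ord0); split=> [x y Sx Sy|i]; first by split=> // _; apply: SB.
by exists 1 => //=; rewrite [RHS]ord1.
Qed.

End LocalToGlobal.

(** * Dirichlet series *)

Section Dirichlet.

Implicit Types f g : dirichlet.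

Definition multiplicative f := f 1%N = 1 /\
  forall m n, (0 < m)%N -> (0 < n)%N -> coprime m n -> f (m * n)%N = f m * f n.

(** Induction on [n], splitting off the full power of its smallest prime divisor. *)
Lemma multiplicative_eq f g : multiplicative f -> multiplicative g ->
  (forall p k, prime p -> f (p ^ k)%N = g (p ^ k)%N) -> dirichlet_eq f g.
Proof.
move=> [f1 fM] [g1 gM] fg n; elim/ltn_ind: n => n IHn n0.
have [n1|n1] := leqP n 1.
  by rewrite (_ : n = 1%N) ?f1 ?g1 //; apply/eqP; rewrite eqn_leq n1.
have p_pr := pdiv_prime n1; set p := pdiv n in p_pr.
rewrite -(partnC p n0) fM ?gM ?part_gt0 ?coprime_partC // p_part fg //.
congr (_ * _); apply: IHn; last exact: part_gt0.
rewrite -[X in (_ < X)%N](partnC p n0) ltn_Pmull ?part_gt0 //.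
rewrite p_part -(exp1n (logn p n)) ltn_exp2r ?prime_gt1 //.
by rewrite logn_gt0 mem_primes p_pr n0 pdiv_dvd.
Qed.

(** A divisor [d] of [m * n] factors as [gcdn d m * gcdn d n]. *)
Lemma divisors_coprime m n : (0 < m)%N -> (0 < n)%N -> coprime m n ->
  perm_eq (divisors (m * n)) [seq (x * y)%N | x <- divisors m, y <- divisors n].
Proof.
move=> m0 n0 cmn; apply: uniq_perm; first exact: divisors_uniq.
  apply: allpairs_uniq; try exact: divisors_uniq.
  move=> _ _ /allpairsP[[x y] [/= xm yn ->]]
    /allpairsP[[x' y'] [/= xm' yn' ->]] /= e.
  move: xm yn xm' yn'; rewrite -!dvdn_divisors // => xm yn xm' yn'.
  have c u v : (u %| m)%N -> (v %| n)%N -> coprime u v.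
    by move=> um vn; apply: coprime_dvdl um _; apply: coprime_dvdr vn cmn.
  have ex : x = x'.
    apply/eqP; rewrite eqn_dvd -(Gauss_dvdl x' (c _ _ xm yn')) -e dvdn_mulr //=.
    by rewrite -(Gauss_dvdl x (c _ _ xm' yn)) e dvdn_mulr.
  move: e; rewrite ex => /eqP; rewrite eqn_pmul2l ?(dvdn_gt0 m0) // => /eqP ->.
  by [].
move=> d; rewrite -dvdn_divisors ?muln_gt0 ?m0 //; apply/idP/allpairsP.
  move=> dmn; exists (gcdn d m, gcdn d n); rewrite -!dvdn_divisors ?dvdn_gcdr //.
  split=> //=; apply/eqP; rewrite eqn_dvd Gauss_dvd ?dvdn_gcdl ?andbT //; last first.
    by apply: coprime_dvdl (dvdn_gcdr _ _) _; apply: coprime_dvdr (dvdn_gcdr _ _) cmn.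
  rewrite muln_gcdl !muln_gcdr !dvdn_gcd dmn (dvdn_mulr d (dvdnn d)).
  by rewrite (dvdn_mulr n (dvdnn d)) (dvdn_mull m (dvdnn d)).
by move=> [[x y] [/=]]; rewrite -!dvdn_divisors // => xm yn ->; apply: dvdn_mul.
Qed.

Lemma multiplicative_mul f g : multiplicative f -> multiplicative g ->
  multiplicative (dirichlet_mul f g).
Proof.
move=> [f1 fM] [g1 gM]; split=> [|m n m0 n0 cmn].
  by rewrite /dirichlet_mul big_seq1 f1 g1.
rewrite /dirichlet_mul (perm_big _ (divisors_coprime m0 n0 cmn)).
rewrite big_allpairs_dep /=.
rewrite big_distrl /=; apply: eq_big_seq => x; rewrite -dvdn_divisors // => xm.
rewrite big_distrr /=; apply: eq_big_seq => y; rewrite -dvdn_divisors // => yn.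
have c u v : (u %| m)%N -> (v %| n)%N -> coprime u v.
  by move=> um vn; apply: coprime_dvdl um _; apply: coprime_dvdr vn cmn.
have [x0 y0] := (dvdn_gt0 m0 xm, dvdn_gt0 n0 yn).
rewrite fM ?c // (_ : (m * n) %/ (x * y) = (m %/ x) * (n %/ y))%N.
  have cq : coprime (m %/ x) (n %/ y) by apply: c; apply: dvdn_div.
  have mx0 : (0 < m %/ x)%N by rewrite divn_gt0 // dvdn_leq.
  have ny0 : (0 < n %/ y)%N by rewrite divn_gt0 // dvdn_leq.
  by rewrite (gM _ _ mx0 ny0 cq) mulrACA.
apply/eqP; rewrite -(eqn_pmul2r (m := x * y)) ?muln_gt0 ?x0 //.
by rewrite divnK ?dvdn_mul // mulnACA !divnK.
Qed.

Lemma multiplicative_one : multiplicative dirichlet_one.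
Proof.
split=> // m n m0 n0 _; rewrite /dirichlet_one muln_eq1.
by case: eqP; case: eqP.
Qed.

Lemma multiplicative_zeta : multiplicative riemann_zeta.
Proof. by split=> // m n _ _ _; rewrite mulr1. Qed.

Lemma multiplicative_exp f k : multiplicative f ->
  multiplicative (dirichlet_exp f k).
Proof.
move=> mf; elim: k => [|k IHk]; first exact: multiplicative_one.
exact: multiplicative_mul.
Qed.

(** The Cauchy product of power series, with unit [delta0]. It is what the Dirichlet product becomes
    on the powers of one prime. *)
Definition conv (u v : nat -> int) k := \sum_(i < k.+1) u i * v (k - i)%N.

Definition delta0 (k : nat) : int := (k == 0)%:R.

Lemma dirichlet_mul_pow f g p k : prime p ->
  dirichlet_mul f g (p ^ k)%N =
    conv (fun j => f (p ^ j)%N) (fun j => g (p ^ j)%N) k.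
Proof.
move=> p_pr; have p1 := prime_gt1 p_pr; have p0 := prime_gt0 p_pr.
rewrite /dirichlet_mul /conv (perm_big [seq (p ^ i)%N | i <- iota 0 k.+1]).
  rewrite big_map -/(index_iota 0 k.+1) big_mkord; apply: eq_bigr => i _.
  by rewrite -expnB // -ltnS.
apply: uniq_perm; first exact: divisors_uniq.
  by rewrite map_inj_uniq ?iota_uniq //; apply: expnI.
move=> x; rewrite -dvdn_divisors ?expn_gt0 ?p0 //.
apply/(dvdn_pfactor _ _ p_pr)/mapP => [[i le_i ->]|[i + ->]].
  by exists i => //; rewrite mem_iota.
by rewrite mem_iota => lt_i; exists i.
Qed.

Lemma dirichlet_one_pow p k : prime p -> dirichlet_one (p ^ k)%N = delta0 k.
Proof.
move=> p_pr; rewrite /dirichlet_one /delta0 -(expn0 p) eqn_exp2l //.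
exact: prime_gt1.
Qed.

Lemma conv_delta0 u k : conv u delta0 k = u k.
Proof.
rewrite /conv big_ord_recr /= subnn mulr1 big1 ?add0r // => i _.
by rewrite /delta0 subn_eq0 leqNgt ltn_ord mulr0.
Qed.

Lemma conv_delta0l u k : conv delta0 u k = u k.
Proof.
by rewrite /conv big_ord_recl /= subn0 mul1r big1 ?addr0 // => i _; rewrite mul0r.
Qed.

Lemma bdiff_conv u v k : bdiff (conv u v) k = conv u (bdiff v) k.
Proof.
case: k => [|k]; rewrite /bdiff /conv /=.
  by rewrite !big_ord1 subr0 /shift /= subr0.
rewrite !(big_ord_recr k.+1) /= subnn subr0 addrAC -sumrB; congr (_ + _).
by apply: eq_bigr => i _; rewrite subSn -1?ltnS //= mulrBr.
Qed.

(** The constant sequence [1] is the series [1 / (1 - T)]. *)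
Lemma bdiff_conv1 v k : bdiff (conv (fun=> 1) v) k = v k.
Proof.
case: k => [|k]; rewrite /bdiff /conv /=; first by rewrite big_ord1 mul1r subr0.
rewrite big_ord_recl /= mul1r subn0.
by rewrite (eq_bigr (fun i : 'I_k.+1 => 1 * v (k - i)%N)) ?addrK.
Qed.

(** Differences can be summed back, since [bdiff f 0] is [f 0]: the series [1 - T] is invertible. *)
Lemma iter_bdiff_inj n f g : iter n bdiff f =1 iter n bdiff g -> f =1 g.
Proof.
elim: n f g => [|n IHn] f g //; rewrite !iterSr => /IHn e k.
elim: k => [|k IHk]; first by have := e 0; rewrite /bdiff /= !subr0.
by have := e k.+1; rewrite /bdiff /= IHk => /addIr.
Qed.

(** At [p], the [d]-th power of zeta is [(1 - T)^-d], which [d] differences cancel. *)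
Lemma conv_zeta_exp u d p k : prime p ->
  iter d bdiff (conv u (fun j => dirichlet_exp riemann_zeta d (p ^ j)%N)) k = u k.
Proof.
move=> p_pr; elim: d k => [|d IHd] k.
  rewrite /= -[RHS]conv_delta0; congr conv; apply/funext => j.
  exact: dirichlet_one_pow.
rewrite iterSr -[RHS]IHd; congr (iter d bdiff _ k); apply/funext => j.
rewrite bdiff_conv; congr (conv u _ j); apply/funext => {}j.
rewrite -[RHS](bdiff_conv1 (fun j => dirichlet_exp riemann_zeta d (p ^ j)%N)).
by congr (bdiff _ j); apply/funext => i; rewrite /= dirichlet_mul_pow.
Qed.

(** Only the exponent [logn p n] can satisfy [n = p ^ k]. *)
Lemma dirichlet_polyE p (q : {poly int}) n : prime p -> (0 < n)%N ->
  dirichlet_poly p q n = q`_(logn p n) *+ (n == p ^ logn p n)%N.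
Proof.
move=> p_pr n0; have p1 := prime_gt1 p_pr.
have e k : (n == p ^ k)%N = (k == logn p n) && (n == p ^ logn p n)%N.
  apply/eqP/andP => [e|[/eqP -> /eqP //]].
  by rewrite e pfactorK ?eqxx.
rewrite /dirichlet_poly; have [lt_n|le_n] := ltnP (logn p n) (size q).
  rewrite (bigD1 (Ordinal lt_n)) //= big1 ?addr0 // => i /negPf ni.
  by rewrite e (_ : _ == _ = false).
rewrite nth_default // mul0rn big1 // => i _.
by rewrite e; case: eqP => // ei; have := ltn_ord i; rewrite ei ltnNge le_n.
Qed.

(** Of two coprime numbers one is prime to [p]. If it is not [1], neither it nor the product is a
    power of [p], and both sides vanish. *)
Lemma multiplicative_poly p (q : {poly int}) : prime p -> q`_0 = 1 ->
  multiplicative (dirichlet_poly p q).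
Proof.
move=> p_pr q0; have p1 := prime_gt1 p_pr.
have coprime_case m n : (0 < m)%N -> (0 < n)%N -> ~~ (p %| n)%N ->
    dirichlet_poly p q (m * n)%N = dirichlet_poly p q m * dirichlet_poly p q n.
  move=> m0 n0 pn; have ln : logn p n = 0%N.
    by apply/eqP; rewrite -leqn0 leqNgt logn_gt0 mem_primes p_pr n0.
  rewrite !dirichlet_polyE ?muln_gt0 ?m0 // lognM // ln addn0 expn0 q0.
  have [->|n1] := eqVneq n 1%N; first by rewrite muln1 mulr1.
  rewrite mulr0 (_ : _ == _ = false) //; apply/negbTE.
  rewrite neq_ltn; apply/orP; right; apply: leq_ltn_trans (_ : m < _)%N.
    by apply: dvdn_leq => //; apply: pfactor_dvdnn.
  by rewrite ltn_Pmulr // ltn_neqAle eq_sym n1.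
split=> [|m n m0 n0 cmn].
  by rewrite dirichlet_polyE // logn1 expn0 eqxx q0.
have [pn|/coprime_case->//] := boolP (p %| n)%N.
rewrite mulnC mulrC coprime_case //; apply: contraL cmn => pm.
rewrite /coprime; apply: contraTneq p1 => g.
by rewrite -leqNgt dvdn_leq // -g dvdn_gcd pm.
Qed.

Lemma dirichlet_poly_pow p (q : {poly int}) k : prime p ->
  dirichlet_poly p q (p ^ k)%N = q`_k.
Proof.
move=> p_pr; rewrite dirichlet_polyE ?expn_gt0 ?prime_gt0 //.
by rewrite pfactorK // eqxx.
Qed.

Lemma dirichlet_poly_pow_neq p (q : {poly int}) p' k :
  prime p -> prime p' -> p != p' -> q`_0 = 1 ->
  dirichlet_poly p q (p' ^ k)%N = delta0 k.
Proof.
move=> p_pr p'_pr pp' q0; rewrite dirichlet_polyE ?expn_gt0 ?prime_gt0 //.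
rewrite lognX logn_prime // (negPf pp') muln0 expn0 q0.
by rewrite -(expn0 p') eqn_exp2l ?prime_gt1.
Qed.

Lemma multiplicative_prod (s : seq nat) (F : nat -> dirichlet) :
  (forall p, p \in s -> multiplicative (F p)) ->
  multiplicative (\big[dirichlet_mul/dirichlet_one]_(p <- s) F p).
Proof.
elim: s => [|p s IHs] mF; first by rewrite big_nil; apply: multiplicative_one.
rewrite big_cons; apply: multiplicative_mul; first by apply: mF; rewrite mem_head.
by apply: IHs => x xs; apply: mF; rewrite inE xs orbT.
Qed.

(** On powers of [p] the factors attached to other primes reduce to the unit [delta0]. *)
Lemma prod_dirichlet_poly_pow (s : seq nat) (delta : nat -> {poly int}) p k :
  uniq s -> (forall q, q \in s -> prime q /\ (delta q)`_0 = 1) -> prime p ->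
  (\big[dirichlet_mul/dirichlet_one]_(q <- s) dirichlet_poly q (delta q))
    (p ^ k)%N =
  if p \in s then (delta p)`_k else delta0 k.
Proof.
move=> + + p_pr; elim: s k => [|q s IHs] k /= us sP.
  by rewrite big_nil dirichlet_one_pow.
have [q_pr q0] := sP q (mem_head _ _).
have {}IHs j : _ = _ := IHs j _ _; move: us => /andP[qs us].
have sP' x : x \in s -> prime x /\ (delta x)`_0 = 1.
  by move=> xs; apply: sP; rewrite inE xs orbT.
rewrite big_cons dirichlet_mul_pow //.
have [pq|pq] := eqVneq q p.
  rewrite -pq mem_head -[RHS]conv_delta0; rewrite -pq in IHs *.
  congr (conv _ _ k); apply/funext => j; first exact: dirichlet_poly_pow.
  by rewrite IHs // (negPf qs).
rewrite inE eq_sym (negPf pq) /=.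
rewrite -[RHS](conv_delta0l (fun j => if p \in s then (delta p)`_j else delta0 j)).
congr (conv _ _ k); apply/funext => j; first exact: dirichlet_poly_pow_neq.
exact: IHs.
Qed.

End Dirichlet.

(** Both sides are multiplicative, so they are compared on powers of a prime [p], after [d]
    differences. The right side then becomes [delta p], or [delta0] when [p] does not divide [N],
    and the left side is [D p]. *)
Theorem ideal_zeta_order (d N : nat) (S : set {ffun 'I_d -> int}) :
  subring S -> (0 < N)%N -> (forall x, S (x *+ N)) ->
  exists delta : nat -> {poly int},
    dirichlet_eq (ideal_zeta S)
      (dirichlet_mul
         (\big[dirichlet_mul/dirichlet_one]_(p <- primes N)
            dirichlet_poly p (delta p))
         (dirichlet_exp riemann_zeta d)).
Proof.
move=> rS N0 condS; have sS := subring_subgroup rS; have [S1 SB SM] := rS.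
pose D p := iter d bdiff (fun j => ideal_zeta S (p ^ j)%N).
(* The degree bound is the last index at which [D p] may be nonzero. *)
pose delta p := \poly_(k < (2 * d * logn p N).+1) D p k.
have Dvanish p k : prime p -> (2 * d * logn p N < k)%N -> D p k = 0.
  by move=> p_pr lt_k; apply: bdiff_ideals_vanish_global rS N0 condS _ _ p_pr lt_k.
have deltaE p k : prime p -> (delta p)`_k = D p k.
  move=> p_pr; rewrite coef_poly; case: ifP => // /negbT.
  by rewrite -leqNgt => lt_k; rewrite Dvanish.
have zeta1 : ideal_zeta S 1 = 1 by rewrite /ideal_zeta -/(ncard _) ideals_of_index1.
have D0 p : D p 0%N = 1.
  (* A difference leaves the value at [0] unchanged, and there is exactly one ideal of index [1]. *)
  by rewrite /D; elim: {1}d => [|m IHm] //=; rewrite /bdiff IHm subr0.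
have primesP q : q \in primes N -> prime q /\ (delta q)`_0 = 1.
  by rewrite mem_primes => /andP[q_pr _]; rewrite deltaE.
exists delta; apply: multiplicative_eq.
- split=> // m n m0 n0 cmn; rewrite /ideal_zeta -PoszM; congr _%:Z.
  by apply: ideals_of_index_mul => //; apply: (finite_ideals rS N0 condS).
- apply: multiplicative_mul; last exact/multiplicative_exp/multiplicative_zeta.
  apply: multiplicative_prod => q /primesP[q_pr q0].
  exact: multiplicative_poly.
move=> p k p_pr; rewrite dirichlet_mul_pow //; move: k.
apply: (@iter_bdiff_inj d) => k.
rewrite conv_zeta_exp // prod_dirichlet_poly_pow ?primes_uniq // -/(D p k).
have [|pN] := boolP (p \in primes N); first by rewrite deltaE.
case: k => [|k]; first exact: D0.
(* For [p] not dividing [N] the vanishing bound is [0], so [D p] is zero at every positive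
   exponent. *)
rewrite Dvanish //; move: pN; rewrite -logn_gt0 -eqn0Ngt => /eqP ->.
by rewrite muln0.
Qed.

(** * The ring generated by a matrix *)

Section Transfer.
Variables (R R' : pzRingType) (S : set R) (S' : set R') (phi : R -> R').
Hypotheses (sS : subgroup S) (sS' : subgroup S') (phiS : phi @` S = S').
Hypothesis phiB : forall x y, S x -> S y -> phi (x - y) = phi x - phi y.
Hypothesis phiM : forall x y, S x -> S y -> phi (x * y) = phi x * phi y.
Hypothesis SM : forall x y, S x -> S y -> S (x * y).
Hypothesis phi_inj : forall x y, S x -> S y -> phi x = phi y -> x = y.

(** Ideals correspond by image and preimage. The hypotheses on [phi] are restricted to [S] because
    it will be built by choice, with arbitrary values elsewhere. *)
Lemma ideals_of_index_transfer n : finite_set (ideals_of_index S' n) ->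
  ncard (ideals_of_index S n) = ncard (ideals_of_index S' n).
Proof.
move=> fin; apply/esym.
have Sphi x : S x -> S' (phi x) by move=> Sx; rewrite -phiS; exists x.
have [S0 _] := sS.
have phi0 : phi 0 = 0 by rewrite -[0 in LHS](subrr 0) phiB // subrr.
have index (I : set R) (J : set R') : ideal_of S' J ->
    (forall x, S x -> I x <-> J (phi x)) -> has_index S I n <-> has_index S' J n.
  move=> iJ IJ; apply: (has_index_iso (ideal_subgroup iJ) phiB sS Sphi IJ _ n) => y.
  rewrite -{1}phiS => -[x Sx <-]; exists x; rewrite subrr; split=> //.
  by case: iJ.
apply: (ncard_eq (f := fun J => [set x | S x /\ J (phi x)]) fin); split.
- move=> J /(ideals_of_indexP _ _ sS')[iJ Jn]; apply/(ideals_of_indexP _ _ sS).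
  have [JS J0 JB JM] := iJ; split.
    split=> [x []//| |x y [Sx Jx] [Sy Jy]|r x Sr [Sx Jx]].
    + by rewrite /= phi0.
    + by split; [exact: subgroupB|rewrite phiB //; apply: JB].
    + have [J1 J2] := JM _ _ (Sphi _ Sr) Jx.
      by split; (split; [exact: SM|rewrite phiM]).
  by apply/(index _ _ iJ) => // x Sx; split=> [[]|].
- have rec J : ideals_of_index S' n J -> J = phi @` [set x | S x /\ J (phi x)].
    move=> /(ideals_of_indexP _ _ sS')[iJ Jn]; have [JS J0 JB JM] := iJ.
    apply/seteqP; split=> [y Jy|_ [x [_ Jx] <-]//].
    by move: (JS _ Jy); rewrite -phiS => -[x Sx xy]; exists x => //; rewrite /= xy.
  by move=> J K; rewrite !inE => Jn Kn e; rewrite (rec J) // e -rec.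
move=> I /(ideals_of_indexP _ _ sS)[iI In]; have [IS I0 IB IM] := iI.
have IJ x : S x -> I x <-> (phi @` I) (phi x).
  move=> Sx; split=> [Ix|[y Iy e]]; first by exists x.
  by rewrite -(phi_inj (IS _ Iy) Sx e).
have iJ : ideal_of S' (phi @` I).
  split=> [_ [x Ix <-]| |_ _ [x Ix <-] [y Iy <-]|r _ + [x Ix <-]].
  - exact/Sphi/IS.
  - by exists 0.
  - by exists (x - y); [exact: IB|rewrite phiB //; exact: IS].
  - rewrite -phiS => -[s Ss <-]; have [I1 I2] := IM s x Ss Ix; have Sx := IS _ Ix.
    by rewrite -!phiM.
exists (phi @` I).
  by apply/(ideals_of_indexP _ _ sS'); split=> //; apply/(index _ _ iJ IJ).
apply/seteqP; split=> x /=; first by move=> [Sx /IJ]; apply.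
by move=> Ix; split; [exact: IS|exists x].
Qed.

End Transfer.

(** * Evaluation at the roots of the minimal polynomial *)

Section Evaluation.
Variables (v : nat) (B : 'M[int]_v.+1) (alpha beta : int).
Hypotheses (alpha_neq0 : alpha != 0) (beta_neq0 : beta != 0)
  (alpha_neq_beta : alpha != beta).
Hypothesis minpolyB : mxminpoly (map_mx intr B : 'M[rat]_v.+1) =
  'X * ('X - alpha%:~R%:P) * ('X - beta%:~R%:P).

Definition node (i : 'I_3) : int := [:: 0; alpha; beta]`_i.

Definition eval3 (f : {poly int}) : {ffun 'I_3 -> int} := [ffun i => f.[node i]].

Lemma eval3B f g : eval3 (f - g) = eval3 f - eval3 g.
Proof. by apply/ffunP => i; rewrite ffun_subE !ffunE hornerD hornerN. Qed.

Lemma eval3M f g : eval3 (f * g) = eval3 f * eval3 g.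
Proof. by apply/ffunP => i; rewrite ffun_mulE !ffunE hornerM. Qed.

(** Both sides say that the minimal polynomial divides [f] over the rationals, as its roots [0],
    [alpha], [beta] are simple. So [<B>] and [gen3] are the same quotient of the integer
    polynomials. *)
Lemma horner_mx_eq0 f : horner_mx B f = 0 <-> eval3 f = 0.
Proof.
have -> : horner_mx B f = 0 <->
    mxminpoly (map_mx intr B : 'M[rat]_v.+1) %| map_poly intr f.
  split=> [Bf|/dvdpP[q e]].
    by apply: mxminpoly_min; rewrite -map_horner_mx Bf map_mx0.
  have /matrixP Bf : map_mx intr (horner_mx B f) = 0 :> 'M[rat]_v.+1.
    by rewrite map_horner_mx e rmorphM /= mx_root_minpoly mulr0.
  apply/matrixP => i j; have := Bf i j; rewrite !mxE => /eqP.
  by rewrite intr_eq0 => /eqP.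
have -> : mxminpoly (map_mx intr B : 'M[rat]_v.+1) =
    \prod_(z <- [:: 0; alpha%:~R; beta%:~R]) ('X - z%:P).
  by rewrite minpolyB !big_cons big_nil subr0 mulr1 mulrA.
have rootE z : root (map_poly intr f : {poly rat}) z%:~R = (f.[z] == 0).
  by rewrite rootE horner_map /= intr_eq0.
have -> : \prod_(z <- [:: 0; alpha%:~R; beta%:~R]) ('X - z%:P) %|
      (map_poly intr f : {poly rat}) <->
    [&& f.[0] == 0, f.[alpha] == 0 & f.[beta] == 0].
  rewrite -!rootE; split=> [dv|fr].
    apply/and3P; split; apply: root_dvdp dv _;
      by rewrite ?root_prod_XsubC !inE ?eqxx ?orbT.
  apply: uniq_roots_dvdp; first by rewrite /= andbT.
  rewrite uniq_rootsE /= !inE !eqr_int !negb_or !(eq_sym 0) !intr_eq0.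
  by rewrite alpha_neq0 beta_neq0 alpha_neq_beta.
split=> [/and3P[/eqP f0 /eqP fa /eqP fb]|/ffunP e].
  by apply/ffunP => -[[|[|[|]]]] //= lt; rewrite !ffunE /node.
have := (e (inord 0), e (inord 1), e (inord 2)).
by rewrite !ffunE /node !inordK // /= => -[[-> ->] ->]; rewrite eqxx.
Qed.

Definition gen3 : set {ffun 'I_3 -> int} := eval3 @` setT.

Lemma subring_gen3 : subring gen3.
Proof.
split=> [|_ _ [f _ <-] [g _ <-]|_ _ [f _ <-] [g _ <-]].
- by exists 1 => //; apply/ffunP => i; rewrite !ffunE hornerC.
- by exists (f - g) => //; rewrite eval3B.
- by exists (f * g) => //; rewrite eval3M.
Qed.

(** Up to sign, the denominators of the interpolation basis are [alpha * beta],
    [alpha * (beta - alpha)] and [beta * (beta - alpha)], all divisors of the multiplier. *)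
Lemma gen3_conductor x : gen3 (x *+ `|(alpha * beta * (beta - alpha))%R|%N).
Proof.
suff h : gen3 (x *~ (alpha * beta * (beta - alpha))).
  have sG := subring_subgroup subring_gen3.
  case: (_ * _) h => n; first by rewrite pmulrn.
  rewrite NegzE mulrNz -pmulrn abszN => /(subgroupN sG).
  by rewrite opprK.
(* Lagrange interpolation at 0, alpha, beta *)
pose x_ k := x (inord k).
exists ((x_ 0%N * (beta - alpha))%:P * ('X - alpha%:P) * ('X - beta%:P)
  - (x_ 1%N * beta)%:P * 'X * ('X - beta%:P)
  + (x_ 2%N * alpha)%:P * 'X * ('X - alpha%:P)) => //.
apply/ffunP => i; rewrite ffun_mulrzE !ffunE !hornerE -mulrzr intz.
have [->|->|->] : [\/ i = inord 0, i = inord 1 | i = inord 2].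
  case: i => [[|[|[|]]]] // lt; [apply: Or31|apply: Or32|apply: Or33];
    by apply: val_inj; rewrite /= inordK.
all: by rewrite /node inordK // /x_ /=; ring.
Qed.

Lemma ideal_zeta_gen_subring :
  dirichlet_eq (ideal_zeta (gen_subring B)) (ideal_zeta gen3).
Proof.
move=> n n0.
have sG := subring_subgroup subring_gen3.
have /choice[rep repP] A : exists f, gen_subring B A -> horner_mx B f = A.
  by have [[f _ <-]|nA] := pselect (gen_subring B A); [exists f|exists 0].
(* The values at the three nodes do not depend on the polynomial chosen for a matrix, so
   [eval3 \o rep] is well behaved on [<B>]. *)
have evalE f : eval3 (rep (horner_mx B f)) = eval3 f.
  apply/eqP; rewrite -subr_eq0 -eval3B; apply/eqP/horner_mx_eq0.
  by rewrite rmorphB /= repP ?subrr //; exists f.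
have N0 : (0 < `|(alpha * beta * (beta - alpha))%R|)%N.
  by rewrite absz_gt0 !mulf_neq0 // subr_eq0 eq_sym.
congr _%:Z; apply: (@ideals_of_index_transfer _ _ _ _ (eval3 \o rep)) => //.
- split; first by exists 0 => //; rewrite rmorph0.
  by move=> _ _ [f _ <-] [g _ <-]; exists (f - g); rewrite ?rmorphB.
- apply/seteqP; split=> [_ [_ [f _ <-] <-]|_ [f _ <-]].
    by exists f; rewrite //= evalE.
  by exists (horner_mx B f); rewrite /= ?evalE //; exists f.
- by move=> _ _ [f _ <-] [g _ <-]; rewrite -rmorphB /= !evalE eval3B.
- by move=> _ _ [f _ <-] [g _ <-]; rewrite -rmorphM /= !evalE eval3M.
- by move=> _ _ [f _ <-] [g _ <-]; exists (f * g); rewrite ?rmorphM.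
- move=> _ _ [f _ <-] [g _ <-] /=; rewrite !evalE => e.
  apply/eqP; rewrite -subr_eq0 -rmorphB; apply/eqP/horner_mx_eq0.
  by rewrite eval3B e subrr.
exact: (finite_ideals subring_gen3 N0 gen3_conductor).
Qed.

End Evaluation.

Theorem mainTheorem1 (v : nat) (B : 'M[int]_v.+1) (alpha beta : int)
    (alpha_neq0 : alpha != 0) (beta_neq0 : beta != 0)
    (alpha_neq_beta : alpha != beta)
    (minpolyB : mxminpoly (map_mx intr B : 'M[rat]_v.+1) =
       'X * ('X - alpha%:~R%:P) * ('X - beta%:~R%:P)) :
  exists delta : nat -> {poly int},
    dirichlet_eq (ideal_zeta (gen_subring B))
      (dirichlet_mul
         (\big[dirichlet_mul/dirichlet_one]_(
             p <- primes `|(alpha * beta * (beta - alpha))%R|%N)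
            dirichlet_poly p (delta p))
         (dirichlet_exp riemann_zeta 3)).
Proof.
have N0 : (0 < `|(alpha * beta * (beta - alpha))%R|)%N.
  by rewrite absz_gt0 !mulf_neq0 // subr_eq0 eq_sym.
have [delta deltaP] :=
  ideal_zeta_order (subring_gen3 alpha beta) N0 (@gen3_conductor alpha beta).
exists delta => n n0; rewrite -deltaP //.
exact: (ideal_zeta_gen_subring alpha_neq0 beta_neq0 alpha_neq_beta minpolyB).
Qed.
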